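(* Let $X$ be any of the algebras $\mathcal{S}$, $\mathrm{Sym}^\odot(\mathcal{S})$ and $\mathcal{T}$. Then $X$ is \begin{itemize} \item quasimodular; \item closed under the pointwise product; \item closed under the induced product if $X\neq \mathcal{S}$. \end{itemize} Moreover, the three algebras are related by $\mathcal{S}\subsetneq \mathrm{Sym}^\odot(\mathcal{S}) \subsetneq \mathcal{T}$.
   Context: $\mathscr{P}$ is the set of integer partitions; for $\lambda\in\mathscr{P}$, $r_m(\lambda)$ is the number of parts of $\lambda$ equal to $m$. The $q$-bracket of $f:\mathscr{P}\to\mathbb{Q}$ is $\langle f\rangle_q=\sum_\lambda f(\lambda)q^{|\lambda|}/\sum_\lambda q^{|\lambda|}$. A graded subalgebra $A$ of $\mathbb{Q}^{\mathscr{P}}$ is called a quasimodular algebra if the $q$-bracket of every homogeneous $f\in A$ is a quasimodular form (for $\mathrm{SL}_2(\mathbb{Z})$) of the same weight as $f$. The Faulhaber polynomial $F_l$ ($l\ge1$) is the polynomial with vanishing constant term such that $F_l(n)=\sum_{i=1}^n i^{l-1}$ for all $n\in\mathbb{Z}_{>0}$. For $k\ge0$, $l\ge1$, $k+l$ even, the double moment function is $T_{k,l}(\lambda)=-\frac{B_{k+l}}{2(k+l)}(\delta_{l,1}+\delta_{k,0})+\sum_{m\ge1}m^kF_l(r_m(\lambda))$ ($B_j$ the Bernoulli numbers). The moment functions are $S_k(\lambda)=-\frac{B_k}{2k}+\sum_i\lambda_i^{k-1}$ for even $k\ge2$ (so $S_k=T_{k-1,1}$). The $\vec u$-bracket is $\langle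 f\rangle_{\vec u}=\sum_\lambda f(\lambda)u_\lambda/\sum_\lambda u_\lambda$ with $u_\lambda=u_{\lambda_1}u_{\lambda_2}\cdots$ formal variables; the induced product $f\odot g$ is defined by $\langle f\odot g\rangle_{\vec u}=\langle f\rangle_{\vec u}\langle g\rangle_{\vec u}$. $\mathcal{S}$ is the algebra generated by the $S_k$ under the pointwise product; $\mathrm{Sym}^\odot(\mathcal{S})$ is generated by the elements of $\mathcal{S}$ under the induced product; $\mathcal{T}$ is generated by the $T_{k,l}$ under the pointwise product. The weight grading: $S_k$ has weight $k$; on $\mathcal{T}$, $T_{k,l}$ is assigned weight $k+l$ and the grading is extended under the induced product (the $T_{k_1,l_1}\odot\cdots\odot T_{k_n,l_n}$ form a basis of $\mathcal{T}$). *)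

(* Defs.v *)
From HB Require Import structures.
From mathcomp Require Import all_boot all_order all_algebra.
Set Implicit Arguments. Unset Strict Implicit. Unset Printing Implicit Defensive.
Import Order.TTheory GRing.Theory Num.Theory.
Local Open Scope ring_scope.

Definition is_partition (s : seq nat) : bool :=
  sorted (fun x y : nat => (y <= x)%N) s && all (fun x => (0 < x)%N) s.

Definition partition := {s : seq nat | is_partition s}.

Definition psize (l : partition) : nat := sumn (val l).

Definition rmult (m : nat) (l : partition) : nat := count_mem m (val l).

Fixpoint seqs_over (s : seq nat) (len : nat) : seq (seq nat) :=
  if len is len'.+1 then flatten [seq [seq x :: t | t <- seqs_over s len'] | x <- s]
  else [:: [::]].

Definition raw_parts (n : nat) : seq (seq nat) :=
  [seq t <- flatten [seq seqs_over (iota 1 n) len | len <- iota 0 n.+1]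
     | is_partition t && (sumn t == n)].

Definition parts (n : nat) : seq partition :=
  pmap (insub : seq nat -> option partition) (raw_parts n).

Definition Pfun := partition -> rat.

Definition pone : Pfun := fun _ => 1.
Definition pzero : Pfun := fun _ => 0.
Definition padd (f g : Pfun) : Pfun := fun l => f l + g l.
Definition pscale (c : rat) (f : Pfun) : Pfun := fun l => c * f l.
Definition ppmul (f g : Pfun) : Pfun := fun l => f l * g l.

Inductive span (P : Pfun -> Prop) : Pfun -> Prop :=
| span0 : span P pzero
| span_gen f : P f -> span P f
| spanD f g : span P f -> span P g -> span P (padd f g)
| spanZ c f : span P f -> span P (pscale c f).

(* ---------- Bernoulli numbers (B_1 = -1/2 convention; only even indices are used) *)
Fixpoint bern_seq (n : nat) : seq rat :=
  match n with
  | 0 => [:: 1]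
  | m.+1 => let s := bern_seq m in
      rcons s (- (m.+2)%:R^-1 * \sum_(j < m.+1) ('C(m.+2, j))%:R * nth 0 s j)
  end.
Definition bern (n : nat) : rat := nth 0 (bern_seq n) n.

Definition series := nat -> rat.
Definition sone : series := fun n => if n == 0%N then 1 else 0.
Definition szero : series := fun _ => 0.
Definition sadd (a b : series) : series := fun n => a n + b n.
Definition sscale (c : rat) (a : series) : series := fun n => c * a n.
Definition smul (a b : series) : series :=
  fun n => \sum_(i < n.+1) a i * b (n - i)%N.

Definition genser (f : Pfun) : series := fun n => \sum_(l <- parts n) f l.

(* F is the q-bracket <f>_q, i.e. F * (sum_lambda q^|lambda|) = sum_lambda f(lambda) q^|lambda|
   (the partition generating function is invertible, having constant term 1). *)
Definition qbracket_is (f : Pfun) (F : series) : Prop :=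
  smul F (genser pone) = genser f.

Definition Eis (k : nat) : series :=
  fun n => if n == 0%N then - bern k / (2 * k)%:R
           else \sum_(d <- divisors n) (d ^ k.-1)%:R.

(* Quasimodular forms (for SL_2(Z), rational q-expansion) of weight k:
   the weight-k part of Q[G_2, G_4, G_6]. *)
Inductive qmf : nat -> series -> Prop :=
| qmf0 k : qmf k szero
| qmf1 : qmf 0 sone
| qmfD k a b : qmf k a -> qmf k b -> qmf k (sadd a b)
| qmfZ k c a : qmf k a -> qmf k (sscale c a)
| qmfM2 k a : qmf k a -> qmf (k + 2) (smul (Eis 2) a)
| qmfM4 k a : qmf k a -> qmf (k + 4) (smul (Eis 4) a)
| qmfM6 k a : qmf k a -> qmf (k + 6) (smul (Eis 6) a).

Definition quasimodular (hom : nat -> Pfun -> Prop) : Prop :=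
  forall k f, hom k f -> exists F, qbracket_is f F /\ qmf k F.

(* coefficient of u_lambda in (sum_a f(a) u_a)(sum_b g(b) u_b) *)
Definition conv (f g : Pfun) : Pfun := fun l =>
  \sum_(i < (psize l).+1) \sum_(a <- parts i) \sum_(b <- parts (psize l - i))
     (if perm_eq (val a ++ val b) (val l) then f a * g b else 0).

(* h = f (.) g  iff <h>_u = <f>_u <g>_u  iff  (sum h u)(sum u) = (sum f u)(sum g u) *)
Definition odot_is (f g h : Pfun) : Prop := forall l, conv h pone l = conv f g l.

Definition Smom (k : nat) : Pfun := fun l =>
  - bern k / (2 * k)%:R + \sum_(x <- val l) (x ^ k.-1)%:R.

(* Faulhaber polynomial evaluated at r in N (F_l(0) = 0 since constant term vanishes) *)
Definition faulhaber (l r : nat) : rat := \sum_(1 <= i < r.+1) (i ^ l.-1)%:R.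

Definition Tmom (k l : nat) : Pfun := fun lam =>
  - bern (k + l) / (2 * (k + l))%:R * ((l == 1%N)%:R + (k == 0%N)%:R)
  + \sum_(1 <= m < (psize lam).+1) (m ^ k)%:R * faulhaber l (rmult m lam).

Inductive Salg : Pfun -> Prop :=
| Salg1 : Salg pone
| SalgS k : ~~ odd k -> (2 <= k)%N -> Salg (Smom k)
| SalgD f g : Salg f -> Salg g -> Salg (padd f g)
| SalgZ c f : Salg f -> Salg (pscale c f)
| SalgM f g : Salg f -> Salg g -> Salg (ppmul f g).

Inductive Smono : nat -> Pfun -> Prop :=
| Smono1 : Smono 0 pone
| SmonoM k j f : ~~ odd j -> (2 <= j)%N -> Smono k f -> Smono (k + j) (ppmul (Smom j) f).

Definition Shom (k : nat) : Pfun -> Prop := span (Smono k).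

Inductive SymS : Pfun -> Prop :=
| SymS_S f : Salg f -> SymS f
| SymSD f g : SymS f -> SymS g -> SymS (padd f g)
| SymSZ c f : SymS f -> SymS (pscale c f)
| SymSO f g h : SymS f -> SymS g -> odot_is f g h -> SymS h.

Inductive SymSgen : nat -> Pfun -> Prop :=
| SymSgen_S k f : Shom k f -> SymSgen k f
| SymSgenO k j f g h : SymSgen k f -> SymSgen j g -> odot_is f g h -> SymSgen (k + j) h.

Definition SymShom (k : nat) : Pfun -> Prop := span (SymSgen k).

Inductive Talg : Pfun -> Prop :=
| Talg1 : Talg pone
| TalgT k l : (1 <= l)%N -> ~~ odd (k + l) -> Talg (Tmom k l)
| TalgD f g : Talg f -> Talg g -> Talg (padd f g)
| TalgZ c f : Talg f -> Talg (pscale c f)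
| TalgM f g : Talg f -> Talg g -> Talg (ppmul f g).

Inductive Tmono : nat -> Pfun -> Prop :=
| Tmono1 : Tmono 0 pone
| TmonoO w k l f h : (1 <= l)%N -> ~~ odd (k + l) -> Tmono w f ->
    odot_is (Tmom k l) f h -> Tmono (k + l + w) h.

Definition Thom (k : nat) : Pfun -> Prop := span (Tmono k).

Definition closed_pointwise (X : Pfun -> Prop) : Prop :=
  forall f g, X f -> X g -> X (ppmul f g).
Definition closed_induced (X : Pfun -> Prop) : Prop :=
  forall f g, X f -> X g -> exists h, odot_is f g h /\ X h.

Definition strict_subset (X Y : Pfun -> Prop) : Prop :=
  (forall f, X f -> Y f) /\ exists f, Y f /\ ~ X f.

(* Main.v *)
(** Identify [f] with the power series [\sum_l f l u_l] in [u_1, u_2, ...]; then the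
   u-bracket is [f / Z] with [Z = \sum_l u_l], and the induced product becomes the
   product of brackets. The bracket of [T_{k,l}] is, up to a constant,
   [p_{k,l} = \sum_m m^k (u_m d/du_m)^(l-1) (u_m / (1 - u_m))].

   Pointwise multiplication by [T_{k,l}] acts on brackets as [\sum_m m^k D_m] (plus a
   constant), where [D_m] is a polynomial of parity [l] in [theta + y],
   [theta = u_m d/du_m], [y = 1/2 + u_m / (1 - u_m)], [theta y = y^2 - 1/4]. Since
   [D_m] only sees the variable [u_m], commuting it past [p_{k',l'}] produces
   [\sum_m m^(k+k') [D_m, -]], an operator of the same kind with [(k+k', l+l')].
   Hence the induced products of the [T_{k,l}] with [(k,l)] in a suitable set span an
   algebra for both products: with all admissible [(k,l)] this is [T], and with
   [k >= l] it is [Sym(S)].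

   The q-bracket of [T_{k,l}] is a derivative of an Eisenstein series. Eisenstein
   series lie in [Q[G_2, G_4, G_6]], which is closed under [q d/dq], by two families
   of convolution identities: summing a function with [f a (a + b) = f (a + b) b] over
   [ax + by = N] and using [(a, b, x, y) -> (a - b, b, x, x + y)] evaluates
   [\sum (f a b - f (a + b) b)] by divisor sums. Taking [f s t = s^n + t^n + (s - t)^n]
   gives the heat equation of the theta function, and [f s t = (s t (s - t))^2] gives
   [G_8 = 120 G_4^2].

   The inclusions are strict because elements of [S] are even in [t] on the partition
   [(t, ..., t)] with [t] parts, and elements of [Sym(S)] are polynomial in the part
   on one-part partitions with value at [0] equal to the value at the empty
   partition. *)
From HB Require Import structures.
From mathcomp Require Import all_boot all_order all_algebra.
From mathcomp Require Import boolp.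
From mathcomp Require Import ring zify.
Require Import Defs.
Set Implicit Arguments. Unset Strict Implicit. Unset Printing Implicit Defensive.
Import Order.TTheory GRing.Theory Num.Theory.
Local Open Scope ring_scope.

(** * Partitions and power series in infinitely many variables *)

(** Only the support of the summand matters; this is what allows the index range of a finite sum to
    be enlarged or cut down freely. *)
Lemma sum_supp (V : nmodType) (T : eqType) (s t : seq T) (F : T -> V) :
  uniq s -> uniq t -> (forall x, F x != 0 -> (x \in s) = (x \in t)) ->
  \sum_(x <- s) F x = \sum_(x <- t) F x.
Proof.
move=> us ut H.
have E r : \sum_(x <- r) F x = \sum_(x <- [seq y <- r | F y != 0]) F x.
  rewrite big_filter [RHS]big_mkcond; apply: eq_bigr => x _.
  by case: eqP.
rewrite E [RHS]E; apply: perm_big; apply: uniq_perm; rewrite ?filter_uniq // => x.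
by rewrite !mem_filter; case: eqP => //= /eqP /H ->.
Qed.

Lemma sum_delta (V : nmodType) (T : eqType) (s : seq T) (F : T -> V) x :
  uniq s -> x \in s -> \sum_(y <- s) (if x == y then F y else 0) = F x.
Proof.
move=> us xs; rewrite (bigD1_seq x) //= eqxx big1 ?addr0 // => y.
by rewrite eq_sym => /negbTE ->.
Qed.

Lemma mem_seqs_over (s t : seq nat) n :
  (t \in seqs_over s n) = (size t == n) && all (mem s) t.
Proof.
elim: n t => [|n IH] t /=; first by rewrite inE; case: t.
apply/flatten_mapP/idP.
  by case=> x xs /mapP[t']; rewrite IH => /andP[/eqP <- Ht] -> /=; rewrite eqxx xs.
case: t => [|x t] //= /andP[st /andP[xs Ht]]; exists x => //.
by apply/mapP; exists t => //; rewrite IH -eqSS st.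
Qed.

Lemma seqs_over_uniq (s : seq nat) n : uniq s -> uniq (seqs_over s n).
Proof.
move=> us; elim: n => //= n IH.
by apply: allpairs_uniq => // -[x t] [y u] _ _ /= [-> ->].
Qed.

Lemma raw_parts_uniq n : uniq (raw_parts n).
Proof.
apply: filter_uniq.
rewrite -[X in flatten X]/([seq _ | len <- _]).
have -> : flatten [seq seqs_over (iota 1 n) len | len <- iota 0 n.+1] =
  [seq t | len <- iota 0 n.+1, t <- seqs_over (iota 1 n) len].
  by congr flatten; apply: eq_map => i; rewrite map_id.
apply: allpairs_uniq_dep; first exact: iota_uniq.
  by move=> x _; apply: seqs_over_uniq; exact: iota_uniq.
move=> [i t] [j u] /allpairsPdep[i' [t' [_ + ->]]] /allpairsPdep[j' [u' [_ + ->]]] /=.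
rewrite !mem_seqs_over => /andP[/eqP <- _] /andP[/eqP <- _] ->; done.
Qed.

Lemma mem_raw_parts n t : (t \in raw_parts n) = is_partition t && (sumn t == n).
Proof.
rewrite mem_filter; case E: (is_partition t && (sumn t == n)); rewrite ?andFb ?andTb //.
case/andP: E => /andP[_ pos] /eqP sz.
apply/flatten_mapP; exists (size t); last first.
  rewrite mem_seqs_over eqxx /=; apply/allP => x xt /=.
  rewrite mem_iota (allP pos) //= add1n ltnS -sz.
  by rewrite (perm_sumn (perm_to_rem xt)) /= leq_addr.
rewrite mem_iota /= add0n ltnS -sz.
elim: t pos {sz} => //= x t IH /andP[x0 /IH].
by rewrite -add1n; exact: leq_add.
Qed.

Lemma parts_uniq n : uniq (parts n).
Proof. by apply: pmap_sub_uniq; exact: raw_parts_uniq. Qed.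

Lemma mem_parts n (l : partition) : (l \in parts n) = (psize l == n).
Proof. by rewrite mem_pmap_sub mem_raw_parts (valP l). Qed.

(** One finite range that contains both halves of every splitting of a partition of size at most
    [N], so that the convolution sums need no dependent bounds. *)
Definition ple (N : nat) : seq partition := [seq l | i <- iota 0 N.+1, l <- parts i].

Lemma mem_ple N (l : partition) : (l \in ple N) = (psize l <= N)%N.
Proof.
apply/allpairsPdep/idP.
  by case=> i [m [+ + ->]]; rewrite mem_iota mem_parts => /andP[_ +] /eqP ->.
by move=> h; exists (psize l), l; rewrite mem_iota mem_parts eqxx.
Qed.

Lemma ple_uniq N : uniq (ple N).
Proof.
apply: allpairs_uniq_dep; first exact: iota_uniq.
  by move=> x _; exact: parts_uniq.
move=> [i t] [j u] /allpairsPdep[i' [t' [_ + ->]]] /allpairsPdep[j' [u' [_ + ->]]] /=.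
by rewrite !mem_parts => /eqP <- /eqP <- ->.
Qed.

Lemma is_partition_sort s :
  all (fun x => (0 < x)%N) s -> is_partition (sort geq s).
Proof.
move=> H; rewrite /is_partition; apply/andP; split.
  by apply: sort_sorted => x y; rewrite /geq /= leq_total.
by rewrite all_sort.
Qed.

(** Zeros are filtered out so that the constructor is total. *)
Definition mkpart (s : seq nat) : partition :=
  exist _ (sort geq [seq x <- s | (0 < x)%N]) (is_partition_sort (filter_all _ s)).

Lemma mkpartE s : all (fun x => (0 < x)%N) s -> val (mkpart s) = sort geq s.
Proof. by move=> /all_filterP /= ->. Qed.

Definition pnil : partition := mkpart [::].
Definition pjoin (a b : partition) : partition := mkpart (val a ++ val b).

Lemma part_pos (l : partition) : all (fun x => (0 < x)%N) (val l).
Proof. by case/andP: (valP l). Qed.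

Lemma perm_join a b : perm_eq (val (pjoin a b)) (val a ++ val b).
Proof. by rewrite mkpartE ?all_cat ?part_pos // perm_sort. Qed.

Lemma part_inj (a b : partition) : perm_eq (val a) (val b) -> a = b.
Proof.
move=> H; apply: val_inj.
have T : transitive geq by move=> x y z; rewrite /geq /= => h1 h2; exact: leq_trans h2 h1.
have A : antisymmetric geq by move=> x y; rewrite /geq /= andbC; exact: anti_leq.
by apply: (sorted_eq T A) => //; [case/andP: (valP a) | case/andP: (valP b)].
Qed.

Lemma pjoinP a b l : (pjoin a b == l) = perm_eq (val a ++ val b) (val l).
Proof.
apply/eqP/idP => [<-|H]; first by rewrite perm_sym perm_join.
by apply: part_inj; rewrite (permPl (perm_join a b)).
Qed.

Lemma pjoinC a b : pjoin a b = pjoin b a.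
Proof.
apply/eqP; rewrite pjoinP perm_sym (permPl (perm_join _ _)).
by rewrite perm_catC.
Qed.

Lemma pjoinA a b c : pjoin a (pjoin b c) = pjoin (pjoin a b) c.
Proof.
apply/eqP; rewrite pjoinP perm_sym (permPl (perm_join _ _)).
rewrite (permPl (perm_cat (perm_join a b) (perm_refl _))) perm_sym.
by rewrite (permPl (perm_cat (perm_refl _) (perm_join b c))) catA.
Qed.

Lemma pjoin0 a : pjoin pnil a = a.
Proof. by apply/eqP; rewrite pjoinP. Qed.

Lemma psize_join a b : psize (pjoin a b) = (psize a + psize b)%N.
Proof. by rewrite /psize (perm_sumn (perm_join a b)) sumn_cat. Qed.

Lemma rmult_join m a b : rmult m (pjoin a b) = (rmult m a + rmult m b)%N.
Proof. by rewrite /rmult -count_cat; apply/permP; exact: perm_join. Qed.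

Lemma psize0 : psize pnil = 0%N.
Proof. by []. Qed.

Lemma psize_eq0 l : (psize l == 0%N) = (l == pnil).
Proof.
apply/idP/eqP => [|-> //].
case: l => -[|x s] i //=; first by move=> _; exact: val_inj.
by case/andP: (i) => _ /= /andP[x0 _]; rewrite /psize /= addn_eq0 eqn0Ngt x0.
Qed.

(** Sizes add under [pjoin], so the size conditions in [conv] follow from [pjoin a b = l] and both
    sums may run over a common range. *)
Lemma convE N (f g : Pfun) l : (psize l <= N)%N ->
  conv f g l = \sum_(a <- ple N) \sum_(b <- ple N)
    (if pjoin a b == l then f a * g b else 0).
Proof.
move=> lN; rewrite /conv.
transitivity (\sum_(i < (psize l).+1) \sum_(a <- parts i) \sum_(b <- ple N)
    (if pjoin a b == l then f a * g b else 0)).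
  apply: eq_bigr => i _; rewrite big_seq [RHS]big_seq; apply: eq_bigr => a.
  rewrite mem_parts => /eqP ai.
  under eq_bigr => b _ do rewrite -pjoinP.
  apply: sum_supp; rewrite ?parts_uniq ?ple_uniq // => b.
  case: (eqVneq (pjoin a b) l) => [jl _|_ /eqP //].
  have := psize_join a b; rewrite jl mem_parts mem_ple => E.
  by have := ltn_ord i; rewrite -ai; lia.
have -> : \sum_(i < (psize l).+1) \sum_(a <- parts i) \sum_(b <- ple N)
    (if pjoin a b == l then f a * g b else 0) =
  \sum_(a <- ple (psize l)) \sum_(b <- ple N)
    (if pjoin a b == l then f a * g b else 0).
  by rewrite [ple (psize l)]/ple big_allpairs_dep -[iota 0 (psize l).+1]/(index_iota 0 (psize l).+1) big_mkord.
apply: sum_supp; rewrite ?ple_uniq // => a; rewrite !mem_ple => H.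
have [b] : exists b, pjoin a b == l.
  case: (boolP (has (fun b => pjoin a b == l) (ple N))) => [/hasP[b _ ?]|/hasPn h].
    by exists b.
  case/eqP: H; rewrite big_seq big1 // => b /h; by case: eqP.
by move/eqP/(congr1 psize); rewrite psize_join; lia.
Qed.

(* [Pfun] becomes the ring of formal power series in [u_1, u_2, ...], with [f]
   standing for [\sum_l f l u_l]; the u-bracket of [f] is then [f / pone]. *)
Definition pconst (c : rat) : Pfun := fun l => if l == pnil then c else 0.

Lemma convC : commutative conv.
Proof.
move=> f g; apply: funext => l.
rewrite !(convE _ _ (leqnn (psize l))) exchange_big /=.
by do 2!apply: eq_bigr => ? _; rewrite pjoinC mulrC.
Qed.

(** Associativity is reduced to this sum over triples, where it becomes associativity of [pjoin]. *)
Lemma conv_triple N f g h l : (psize l <= N)%N ->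
  conv (conv f g) h l = \sum_(a <- ple N) \sum_(b <- ple N) \sum_(c <- ple N)
     (if pjoin (pjoin a b) c == l then f a * g b * h c else 0).
Proof.
move=> lN; rewrite (convE _ _ lN).
transitivity (\sum_(d <- ple N) \sum_(c <- ple N) \sum_(a <- ple N) \sum_(b <- ple N)
  if pjoin a b == d then if pjoin d c == l then f a * g b * h c else 0 else 0).
  apply: eq_big_seq => d; rewrite mem_ple => dN; apply: eq_big_seq => c _.
  rewrite (convE _ _ dN); case: ifP => _; last by rewrite !big1 // => a _; rewrite big1 // => b _; case: ifP.
  by rewrite mulr_suml; apply: eq_bigr => a _; rewrite mulr_suml; apply: eq_bigr => b _; case: ifP => _; rewrite ?mul0r.
under eq_bigr => d _ do rewrite exchange_big /=.
rewrite exchange_big /=; apply: eq_bigr => a _.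
under eq_bigr => d _ do rewrite exchange_big /=.
rewrite exchange_big /=; apply: eq_bigr => b _.
rewrite exchange_big /=; apply: eq_bigr => c _.
(* If the join of [a] and [b] is larger than [N], it is no index [d], and joined with [c] it cannot
   give [l]: both sides vanish. *)
case: (leqP (psize (pjoin a b)) N) => abN.
  by rewrite (sum_delta (fun d => if pjoin d c == l then f a * g b * h c else 0)) ?ple_uniq ?mem_ple.
case: eqP => [E|_].
  by move: abN lN; rewrite -E (psize_join (pjoin a b)); lia.
by rewrite big1_seq // => d /= dN; case: eqP => // E; move: dN; rewrite -E mem_ple leqNgt abN.
Qed.

Lemma convA : associative conv.
Proof.
move=> f g h; apply: funext => l; rewrite (convC f).
rewrite !(conv_triple _ _ _ (leqnn (psize l))).
under eq_bigr => b _ do rewrite exchange_big /=.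
rewrite exchange_big /=.
apply: eq_bigr => i _; apply: eq_bigr => j _; apply: eq_bigr => k _.
by rewrite [pjoin (pjoin j k) i]pjoinC pjoinA mulrC mulrA.
Qed.

Lemma conv1f : left_id (pconst 1) conv.
Proof.
move=> f; apply: funext => l; rewrite (convE _ _ (leqnn _)).
rewrite (bigD1_seq pnil) ?ple_uniq ?mem_ple //= [X in _ + X]big1 ?addr0.
  under eq_bigr => b _ do rewrite pjoin0 eq_sym /pconst eqxx mul1r.
  by rewrite sum_delta ?ple_uniq ?mem_ple.
move=> a /negbTE a0; rewrite big1 // => b _.
by rewrite /pconst a0 mul0r; case: ifP.
Qed.

Lemma convDl : left_distributive conv padd.
Proof.
move=> f g h; apply: funext => l; rewrite /padd !(convE _ _ (leqnn (psize l))) -big_split.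
apply: eq_bigr => a _; rewrite -big_split; apply: eq_bigr => b _ /=.
by case: ifP; rewrite ?mulrDl ?addr0.
Qed.

Lemma convZl c (f g : Pfun) : pscale c (conv f g) = conv (pscale c f) g.
Proof.
apply: funext => l; rewrite /pscale !(convE _ _ (leqnn (psize l))) mulr_sumr.
apply: eq_bigr => a _; rewrite mulr_sumr; apply: eq_bigr => b _ /=.
by case: ifP; rewrite ?mulr0 ?mulrA.
Qed.

Definition popp (f : Pfun) : Pfun := fun l => - f l.

HB.instance Definition _ := gen_eqMixin Pfun.
HB.instance Definition _ := gen_choiceMixin Pfun.

Lemma paddA : associative padd.
Proof. by move=> f g h; apply: funext => l; rewrite /padd addrA. Qed.
Lemma paddC : commutative padd.
Proof. by move=> f g; apply: funext => l; rewrite /padd addrC. Qed.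
Lemma padd0 : left_id pzero padd.
Proof. by move=> f; apply: funext => l; rewrite /padd /pzero add0r. Qed.
Lemma paddN : left_inverse pzero popp padd.
Proof. by move=> f; apply: funext => l; rewrite /padd /popp addNr. Qed.
HB.instance Definition _ := GRing.isZmodule.Build Pfun paddA paddC padd0 paddN.

Lemma pconst1_neq0 : pconst 1 != 0 :> Pfun.
Proof. by apply/eqP => /(congr1 (fun f : Pfun => f pnil)). Qed.
HB.instance Definition _ :=
  GRing.Zmodule_isComNzRing.Build Pfun convA convC conv1f convDl pconst1_neq0.

Lemma pscaleA a b f : pscale a (pscale b f) = pscale (a * b) f.
Proof. by apply: funext => l; rewrite /pscale mulrA. Qed.
Lemma pscale1 : left_id 1 pscale.
Proof. by move=> f; apply: funext => l; rewrite /pscale mul1r. Qed.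
Lemma pscaleDr : right_distributive pscale padd.
Proof. by move=> a f g; apply: funext => l; rewrite /pscale /padd mulrDr. Qed.
Lemma pscaleDl f : {morph pscale^~ f : a b / a + b >-> padd a b}.
Proof. by move=> a b; apply: funext => l; rewrite /pscale /padd mulrDl. Qed.
HB.instance Definition _ :=
  GRing.Zmodule_isLmodule.Build rat Pfun pscaleA pscale1 pscaleDr pscaleDl.
HB.instance Definition _ := GRing.Lmodule_isLalgebra.Build rat Pfun convZl.
HB.instance Definition _ := GRing.Lalgebra_isComAlgebra.Build rat Pfun.

Lemma sum_pfunE (I : Type) (r : seq I) (P : pred I) (F : I -> Pfun) l :
  (\sum_(i <- r | P i) F i) l = \sum_(i <- r | P i) F i l.
Proof. exact: (big_morph (fun f : Pfun => f l)). Qed.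

Lemma mulE N (f g : Pfun) l : (psize l <= N)%N ->
  (f * g) l = \sum_(a <- ple N) \sum_(b <- ple N)
    (if pjoin a b == l then f a * g b else 0).
Proof. exact: convE. Qed.

Local Notation Z := (pone : Pfun).

Lemma odotE f g h : odot_is f g h <-> h * Z = f * g.
Proof.
split; first by move=> H; apply: funext => l; exact: H.
by move=> /(congr1 (fun u : Pfun => u _)) H l; move: (H l).
Qed.

(** * Euler operators *)

Lemma addpE (f g : Pfun) l : (f + g) l = f l + g l. Proof. by []. Qed.
Lemma subpE (f g : Pfun) l : (f - g) l = f l - g l. Proof. by []. Qed.
Lemma onepE l : (1 : Pfun) l = if l == pnil then 1 else 0. Proof. by []. Qed.
Lemma scalepE c (f : Pfun) l : (c *: f) l = c * f l. Proof. by []. Qed.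

(** The filtration by total degree, with [u_m] of degree [m]; it provides the topology for the
    infinite sums below. *)
Definition vanish (n : nat) (f : Pfun) := forall l, (psize l < n)%N -> f l = 0.

Lemma vanishM n m f g : vanish n f -> vanish m g -> vanish (n + m) (f * g).
Proof.
move=> Hf Hg l ln; rewrite (mulE _ _ (leqnn _)) big1 // => a _; rewrite big1 // => b _.
case: eqP => // E; move: ln; rewrite -E psize_join => ln.
case: (ltnP (psize a) n) => [/Hf ->|an]; first by rewrite mul0r.
by rewrite Hg ?mulr0 //; lia.
Qed.

Lemma vanishMl n f g : vanish n g -> vanish n (f * g).
Proof. by move=> H; rewrite -[n]add0n; exact: vanishM. Qed.

Lemma vanishMr n f g : vanish n f -> vanish n (f * g).
Proof. by rewrite mulrC; exact: vanishMl. Qed.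

Lemma mul_nil (f g : Pfun) : (f * g) pnil = f pnil * g pnil.
Proof.
rewrite (@mulE 0) // (_ : ple 0 = [:: pnil]).
  by rewrite !big_seq1 pjoin0 eqxx.
apply: perm_small_eq => //; apply: uniq_perm; rewrite ?ple_uniq // => l.
by rewrite mem_ple inE leqn0 psize_eq0.
Qed.

Lemma exp_vanish (f : Pfun) n : f pnil = 0 -> vanish n (f ^+ n).
Proof.
move=> f0; have v1 : vanish 1 f by move=> l; rewrite ltnS leqn0 psize_eq0 => /eqP ->.
by elim: n => [|n IH] //; rewrite exprS -add1n; exact: vanishM.
Qed.

Definition pinv (f : Pfun) : Pfun :=
  fun l => (\sum_(k < (psize l).+1) (1 - f) ^+ k : Pfun) l.

(* The geometric series in [1 - f], of which only finitely many terms contribute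
   to each coefficient. *)
Lemma pinvP (f : Pfun) : f pnil = 1 -> f * pinv f = 1.
Proof.
move=> f1; set g : Pfun := 1 - f.
have g0 : g pnil = 0 by change (1 - f pnil = 0); rewrite f1 subrr.
apply: funext => l; set n := psize l.
pose s : Pfun := \sum_(k < n.+1) g ^+ k.
have Hs : vanish n.+1 (pinv f - s).
  move=> m mn; change (pinv f m - s m = 0); apply/eqP; rewrite subr_eq0; apply/eqP.
  rewrite /pinv /s -/g (_ : n.+1 = (psize m).+1 + (n - psize m))%N; last by lia.
  rewrite big_split_ord /= addpE.
  rewrite [X in _ + X]sum_pfunE [X in _ + X]big1 ?addr0 // => i _.
  by apply: (exp_vanish g0); rewrite leq_addr.
have -> : f * pinv f = f * s + f * (pinv f - s) by rewrite mulrBr addrC subrK.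
rewrite addpE (vanishMl _ Hs) // addr0.
have -> : f = 1 - g by rewrite /g opprB addrC subrK.
rewrite /s -opprB mulNr -subrX1 opprB subpE.
by rewrite (exp_vanish g0) // subr0.
Qed.

Lemma pfun_regl (f g h : Pfun) : f pnil = 1 -> f * g = f * h -> g = h.
Proof.
move=> /pinvP f1 /(congr1 (fun u => pinv f * u)).
by rewrite !mulrA ![pinv f * f]mulrC f1 !mul1r.
Qed.

Definition Zi : Pfun := pinv Z.
Lemma ZK : Z * Zi = 1. Proof. exact: pinvP. Qed.
Lemma ZiK : Zi * Z = 1. Proof. by rewrite mulrC ZK. Qed.

Definition additive_on (a : partition -> rat) := forall l m, a (pjoin l m) = a l + a m.

(** The value of [a] at [l] is distributed over the two halves of each splitting of [l]. *)
Lemma ppmul_leibniz a (f g : Pfun) : additive_on a ->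
  ppmul a (f * g) = ppmul a f * g + f * ppmul a g.
Proof.
move=> Ha; apply: funext => l; rewrite addpE /ppmul.
rewrite !(mulE _ _ (leqnn (psize l))) mulr_sumr -big_split; apply: eq_bigr => b _.
rewrite mulr_sumr -big_split; apply: eq_bigr => c _ /=.
case: eqP => [<-|_]; rewrite ?mulr0 ?addr0 // Ha; ring.
Qed.

Lemma ppmulD (a f g : Pfun) : ppmul a (f + g) = ppmul a f + ppmul a g.
Proof. by apply: funext => l; exact: mulrDr. Qed.
Lemma ppmulZ c (a f : Pfun) : ppmul a (c *: f) = c *: ppmul a f.
Proof. by apply: funext => l; exact: mulrCA. Qed.
Lemma ppmulDl (a b f : Pfun) : ppmul (a + b) f = ppmul a f + ppmul b f.
Proof. by apply: funext => l; exact: mulrDl. Qed.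
Lemma ppmulZl c (a f : Pfun) : ppmul (c *: a) f = c *: ppmul a f.
Proof. by apply: funext => l; rewrite /ppmul !scalepE -mulrA. Qed.
Lemma ppmulC (f g : Pfun) : ppmul f g = ppmul g f.
Proof. by apply: funext => l; exact: mulrC. Qed.
Lemma ppmulA (f g h : Pfun) : ppmul f (ppmul g h) = ppmul (ppmul f g) h.
Proof. by apply: funext => l; exact: mulrA. Qed.
Lemma ppmul1 (f : Pfun) : ppmul pone f = f.
Proof. by apply: funext => l; exact: mul1r. Qed.
Lemma ppmulf1 (f : Pfun) : ppmul f pone = f.
Proof. by rewrite ppmulC ppmul1. Qed.

(* The part [i.+1] is indexed by [i]; [theta i] is the Euler operator
   [u d/du] in the variable [u = u_{i+1}]. *)
Definition mlt (i : nat) (l : partition) : nat := rmult i.+1 l.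
Definition rpow (i n : nat) : Pfun := fun l => (mlt i l)%:R ^+ n.
Definition theta (i : nat) (f : Pfun) : Pfun := ppmul (rpow i 1) f.

Lemma mlt_join i a b : mlt i (pjoin a b) = (mlt i a + mlt i b)%N.
Proof. exact: rmult_join. Qed.
Lemma mlt_nil i : mlt i pnil = 0%N. Proof. by []. Qed.

Lemma rpow1_additive i : additive_on (rpow i 1).
Proof. by move=> a b; rewrite /rpow !expr1 mlt_join natrD. Qed.

Lemma thetaM i f g : theta i (f * g) = theta i f * g + f * theta i g.
Proof. exact: ppmul_leibniz (rpow1_additive i). Qed.
Lemma thetaD i f g : theta i (f + g) = theta i f + theta i g.
Proof. exact: ppmulD. Qed.
Lemma thetaZ i c f : theta i (c *: f) = c *: theta i f.
Proof. exact: ppmulZ. Qed.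
HB.instance Definition _ i := GRing.isAdditive.Build Pfun Pfun (theta i)
  (fun f g => etrans (thetaD i f (- g)) (congr1 _ (etrans (congr1 _ (esym (scaleN1r g)))
     (etrans (thetaZ i _ _) (scaleN1r _))))).

Lemma theta1 i : theta i 1 = 0.
Proof.
apply: funext => l; rewrite /theta /ppmul onepE.
by case: eqP => [->|_]; rewrite ?mulr0 // mulr1 /rpow mlt_nil.
Qed.

Definition psing (i : nat) : partition := mkpart [:: i.+1].

Lemma mlt_psing i j : mlt i (psing j) = (j == i)%N.
Proof. by rewrite /mlt /rmult mkpartE //= eqSS addn0 eq_sym. Qed.

Lemma psize_psing i : psize (psing i) = i.+1.
Proof. by rewrite /psize mkpartE //= addn0. Qed.

Lemma join_psing_inj i : injective (pjoin (psing i)).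
Proof.
move=> a b /eqP; rewrite pjoinP => H; apply: part_inj.
move: H; rewrite (permPr (perm_join _ _)) perm_cat2l; exact.
Qed.

Lemma psing_split i l : (0 < mlt i l)%N -> exists m, l = pjoin (psing i) m.
Proof.
rewrite /mlt /rmult -has_count has_pred1 => il.
have pr : all (fun x => (0 < x)%N) (rem i.+1 (val l)).
  by apply/allP => x /mem_rem; apply: (allP (part_pos l)).
exists (mkpart (rem i.+1 (val l))); apply: part_inj.
apply: perm_trans (perm_to_rem il) _; rewrite perm_sym.
rewrite (permPl (perm_join _ _)) !mkpartE // -[X in perm_eq _ X]cat1s.
by rewrite perm_cat // ?perm_sort ?perm_refl.
Qed.

Variant psing_spec i l : nat -> Type :=
  | PsingIn m of l = pjoin (psing i) m : psing_spec i l (mlt i m).+1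
  | PsingOut of mlt i l = 0%N : psing_spec i l 0.

Lemma psingP i l : psing_spec i l (mlt i l).
Proof.
case E: (mlt i l) => [|n]; first by constructor.
have [|m Hm] := cid (@psing_split i l _); first by rewrite E.
have -> : n = mlt i m by move: E; rewrite Hm mlt_join mlt_psing eqxx; case.
by constructor.
Qed.

Definition uvar (i : nat) : Pfun := fun l => if l == psing i then 1 else 0.

Lemma uvarM_in i f m : (uvar i * f) (pjoin (psing i) m) = f m.
Proof.
set l := pjoin _ _.
have lN : (psize (psing i) + psize m <= psize l)%N by rewrite psize_join.
rewrite (mulE _ _ (leqnn (psize l))) (bigD1_seq (psing i)) ?ple_uniq ?mem_ple //=; last by lia.
rewrite [X in _ + X]big1 ?addr0; last first.
  by move=> a /negbTE ai; rewrite big1 // => b _; rewrite /uvar ai mul0r; case: ifP.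
rewrite (bigD1_seq m) ?ple_uniq ?mem_ple //=; last by lia.
rewrite eqxx /uvar eqxx mul1r big1 ?addr0 // => b /negbTE bm.
by rewrite (inj_eq (@join_psing_inj i)) bm.
Qed.

Lemma uvarM_out i f l : mlt i l = 0%N -> (uvar i * f) l = 0.
Proof.
move=> il; rewrite (mulE _ _ (leqnn (psize l))) big1 // => a _; rewrite big1 // => b _.
case: eqP => // E; rewrite /uvar; case: eqP => [ai|]; rewrite ?mul0r //.
by move: il; rewrite -E ai mlt_join mlt_psing eqxx.
Qed.

Lemma uvarE i l : uvar i l = (uvar i * 1) l. Proof. by rewrite mulr1. Qed.

(** The monomials [u^r], [r > 0], in [u = u_{i+1}] alone. They are the support of [xvar i], the
    expansion of [u / (1 - u)]. *)
Definition umono (i : nat) (l : partition) : bool :=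
  (0 < mlt i l)%N && all (pred1 i.+1) (val l).
Definition xvar (i : nat) : Pfun := fun l => (umono i l)%:R.
(** The denominator of [xvar i]. Its constant term is 1, so it can be cancelled, and identities for
    [xvar] are checked after multiplying by it. *)
Definition cou (i : nat) : Pfun := 1 - uvar i.

Lemma cou_nil i : cou i pnil = 1.
Proof.
rewrite /cou subpE /uvar; case: eqP => [E|_]; last by rewrite subr0.
by have := congr1 psize E; rewrite psize_psing.
Qed.

Lemma couE i f l : (cou i * f) l = f l - (uvar i * f) l.
Proof. by rewrite /cou mulrBl mul1r. Qed.

Lemma umono_join i m : umono i (pjoin (psing i) m) = (m == pnil) || umono i m.
Proof.
rewrite /umono mlt_join mlt_psing eqxx (perm_all _ (perm_join _ _)) all_cat mkpartE //= eqxx /=.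
case: (m =P pnil) => [-> //|/eqP m0] /=.
case A: (all _ _); rewrite ?andbF // andbT; symmetry.
rewrite /mlt /rmult -has_count; move: m0; rewrite -psize_eq0 /psize.
by move: A; rewrite -[val m]/(sval m); case: (sval m) => //= x s /andP[-> ].
Qed.

Lemma xvar_cou i : cou i * xvar i = uvar i.
Proof.
apply: funext => l; rewrite couE [RHS]uvarE.
case: (psingP i l) => [m ->|il]; last by rewrite !uvarM_out // /xvar /umono il subrr.
rewrite !uvarM_in /xvar umono_join onepE.
by case: eqP => [->|_] /=; rewrite ?subrr // /umono mlt_nil subr0.
Qed.

Lemma theta_uvar i j : theta i (uvar j) = if i == j then uvar j else 0.
Proof.
apply: funext => l; rewrite /theta /ppmul /uvar /rpow.
case: (l =P psing j) => [->|lj]; rewrite ?mulr0.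
  by rewrite mlt_psing eq_sym; case: (i == j); rewrite ?mul0r ?eqxx ?mulr1.
by case: (i == j); rewrite ?(introF eqP lj).
Qed.

Lemma theta_cou i j : theta i (cou j) = if i == j then - uvar j else 0.
Proof. by rewrite raddfB /= theta1 theta_uvar; case: eqP; rewrite ?sub0r ?oppr0. Qed.

(** Since [Z] is the product of the [1 / (1 - u_m)], its logarithmic derivative in [u] is
    [u / (1 - u)]. On coefficients: removing one part [i+1] lowers the multiplicity by one. *)
Lemma theta_Z i : theta i Z = xvar i * Z.
Proof.
apply: (pfun_regl (cou_nil i)); rewrite mulrA xvar_cou.
apply: funext => l; rewrite couE.
case: (psingP i l) => [m ->|il].
  by rewrite !uvarM_in /theta /ppmul /rpow mlt_join mlt_psing eqxx !mulr1 natrD addrK.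
by rewrite !uvarM_out // /theta /ppmul /rpow il mul0r subr0.
Qed.

Lemma theta_xvar i : theta i (xvar i) = xvar i + xvar i ^+ 2.
Proof.
apply: (pfun_regl (cou_nil i)).
have := congr1 (theta i) (xvar_cou i).
rewrite thetaM theta_cou theta_uvar eqxx mulNr addrC => /eqP; rewrite subr_eq => /eqP ->.
rewrite mulrDr expr2 mulrA xvar_cou; ring.
Qed.

Lemma theta_xvar_neq i j : i != j -> theta i (xvar j) = 0.
Proof.
move=> ij; apply: funext => l; rewrite /theta /ppmul /xvar /umono /rpow.
case: (boolP (all _ _)) => [al|]; last by rewrite andbF mulr0.
rewrite (_ : mlt i l = 0%N) ?mul0r // /mlt /rmult; apply/count_memPn.
by apply/negP => /(allP al) /=; rewrite eqSS (negbTE ij).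
Qed.

(** The shift by 1/2 turns the derivative [x + x^2] of [x] into [y^2 - 1/4], which is even in [y];
    parity in [y] can then be tracked. *)
Definition yvar (i : nat) : Pfun := xvar i + 2^-1%:A.

Lemma theta_const i c : theta i c%:A = 0.
Proof. by rewrite thetaZ theta1 scaler0. Qed.

Lemma theta_yvar i : theta i (yvar i) = yvar i ^+ 2 - 4^-1%:A.
Proof.
set h : Pfun := 2^-1%:A.
have h2 : h * 2 = 1 by rewrite mulr_algl -[2]/(2%:R) -scaler_nat scalerA mulVf ?scale1r.
have -> : 4^-1%:A = h ^+ 2 by rewrite /h expr2 mulr_algl scalerA -invfM -natrM.
rewrite /yvar -/h thetaD theta_const addr0 theta_xvar.
by rewrite -[X in X + _ = _]mul1r -h2; ring.
Qed.

Lemma theta_yvar_neq i j : i != j -> theta i (yvar j) = 0.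
Proof. by move=> ij; rewrite /yvar thetaD theta_const theta_xvar_neq ?addr0. Qed.

(** * Polynomials of given parity *)

(** Parity bookkeeping: it is what keeps [k + l] even for all the index pairs that arise from
    commutators. *)
Definition parpoly (d : nat) (P : {poly rat}) :=
  (size P <= d.+1)%N /\ forall k, odd k != odd d -> P`_k = 0.

Lemma parpolyD d P Q : parpoly d P -> parpoly d Q -> parpoly d (P + Q).
Proof.
move=> [sP pP] [sQ pQ]; split; last by move=> k kd; rewrite coefD pP ?pQ ?addr0.
by rewrite (leq_trans (size_polyD _ _)) // geq_max sP.
Qed.

Lemma parpolyZ d c P : parpoly d P -> parpoly d (c *: P).
Proof.
move=> [sP pP]; split; last by move=> k kd; rewrite coefZ pP ?mulr0.
exact: leq_trans (size_scale_leq _ _) sP.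
Qed.

Lemma parpoly0 d : parpoly d 0.
Proof. by split; rewrite ?size_poly0 // => k _; rewrite coef0. Qed.

Lemma parpolyB d P Q : parpoly d P -> parpoly d Q -> parpoly d (P - Q).
Proof. by move=> HP HQ; rewrite -scaleN1r; apply: parpolyD => //; exact: parpolyZ. Qed.

Lemma parpoly_sum d (I : Type) (r : seq I) (A : pred I) (F : I -> {poly rat}) :
  (forall i, A i -> parpoly d (F i)) -> parpoly d (\sum_(i <- r | A i) F i).
Proof. by move=> H; apply: big_ind => //; [exact: parpoly0 | exact: parpolyD]. Qed.

Lemma parpolyW d e P : (d <= e)%N -> odd d = odd e -> parpoly d P -> parpoly e P.
Proof. by move=> de oe [sP pP]; split; [exact: leq_trans sP _ | rewrite -oe]. Qed.

Lemma parpolyM d e P Q : parpoly d P -> parpoly e Q -> parpoly (d + e) (P * Q).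
Proof.
move=> [sP pP] [sQ pQ]; split.
  by rewrite (leq_trans (size_polyMleq _ _)) //; lia.
move=> k kd; rewrite coefM big1 // => i _.
case: (boolP (odd i == odd d)) => [/eqP oi|/pP ->]; last by rewrite mul0r.
rewrite pQ ?mulr0 // oddB ?oi; last by rewrite -ltnS.
by move: kd; rewrite oddD; case: (odd k) (odd d) (odd e) => [] [] [].
Qed.

Lemma parpolyX : parpoly 1 'X.
Proof. by split; rewrite ?size_polyX // => -[|[|k]]; rewrite coefX. Qed.

Lemma parpolyC c : parpoly 0 c%:P.
Proof. by split; [exact: size_polyC_leq1 | case=> [|k]; rewrite coefC]. Qed.

(** The family is triangular: a multiple of [g d] removes the leading term, and the induction
    continues in degree [d - 2]. *)
Lemma parpoly_basis (g : nat -> {poly rat}) :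
  (forall j, parpoly j (g j)) -> (forall j, (g j)`_j != 0) ->
  forall d P, parpoly d P ->
  exists c : nat -> rat, P = \sum_(j < d.+1 | odd j == odd d) c j *: g j.
Proof.
move=> Vg g0 d; elim/ltn_ind: d => d IH P VP.
pose a := P`_d / (g d)`_d.
have V' : parpoly d (P - a *: g d) by apply: parpolyB => //; apply: parpolyZ.
have c0 : (P - a *: g d)`_d = 0 by rewrite coefB coefZ mulfVK ?subrr.
case: d => [|[|d]] in IH VP Vg g0 a V' c0 *.
- exists (fun=> a); rewrite big_mkcond big_ord1 /=; apply/eqP; rewrite -subr_eq0.
  by have [/size1_polyC ->] := V'; rewrite c0.
- exists (fun=> a); rewrite big_mkcond big_ord_recr big_ord1 /= add0r.
  apply/eqP; rewrite -subr_eq0; apply/eqP/polyP => k; rewrite coef0.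
  case: V' => sP pP; case: k => [|[|k]] //; first exact: pP.
  by rewrite nth_default // (leq_trans sP).
(* Once the leading coefficient is gone, parity also kills the coefficient of degree [d + 1]. *)
have VW : parpoly d (P - a *: g d.+2).
  case: V' => sP pP; split; last by move=> k kd; apply: pP; rewrite /= negbK.
  apply/leq_sizeP => j; rewrite leq_eqVlt => /orP[/eqP <-|].
    by apply: pP; rewrite /= negbK; case: (odd d).
  rewrite leq_eqVlt => /orP[/eqP <- //|dj].
  by rewrite nth_default // (leq_trans sP).
have [//|c Hc] := IH d _ _ VW.
exists (fun j => if j == d.+2 then a else c j).
rewrite big_mkcond big_ord_recr /= negbK eqxx -big_mkcond /=.
rewrite big_mkcond big_ord_recr /= (_ : (~~ odd d == odd d) = false) ?addr0; last by case: (odd d).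
rewrite eqxx -[LHS](subrK (a *: g d.+2)) Hc big_mkcond; congr (_ + _).
apply: eq_bigr => i _.
by rewrite (_ : (i == d.+2 :> nat) = false) //; have := ltn_ord i; lia.
Qed.

(* Even and odd parts in [c] of [(X + c)^n]. *)
Lemma parpoly_shift (n : nat) (c : rat) :
  exists s t : {poly rat}, [/\ ('X + c%:P) ^+ n = s + t, ('X - c%:P) ^+ n = s - t,
    parpoly n s /\ s`_n = 1 & if n is m.+1 then parpoly m t /\ t`_m = n%:R * c else t = 0].
Proof.
elim: n => [|n [s [t [E1 E2 [Vs s1] Vt]]]].
  by exists 1, 0; rewrite !expr0 addr0 subr0 coef1; split => //; split => //; exact: parpolyC.
exists ('X * s + c *: t), ('X * t + c *: s); rewrite !exprS E1 E2 -!mul_polyC.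
have VXs : parpoly n.+1 ('X * s) by rewrite -add1n; apply: parpolyM => //; exact: parpolyX.
split; try ring.
  split; last first.
    rewrite coefD coefXM s1 mul_polyC coefZ.
    case: n Vt {E1 E2 Vs s1 VXs} => [->|n [[st _] _]]; first by rewrite coef0 mulr0 addr0.
    by rewrite [t`__]nth_default ?mulr0 ?addr0 // (leq_trans st).
  apply: parpolyD => //; rewrite mul_polyC; apply: parpolyZ.
  case: n Vt {E1 E2 Vs s1 VXs} => [->|n [Vt _]]; first exact: parpoly0.
  by apply: parpolyW Vt; [lia | rewrite /= negbK].
split.
  apply: parpolyD; last by rewrite mul_polyC; exact: parpolyZ.
  case: n Vt {E1 E2 Vs s1 VXs} => [->|n [Vt _]]; first by rewrite mulr0; exact: parpoly0.
  by rewrite -add1n; apply: parpolyM => //; exact: parpolyX.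
rewrite coefD coefXM mul_polyC coefZ s1 mulr1.
case: n Vt {E1 E2 Vs s1 VXs} => [_|n [_ /= ->]]; first by rewrite add0r mul1r.
by rewrite -[in RHS]natr1 mulrDl mul1r.
Qed.

(** * Faulhaber polynomials and polynomials in [yvar] *)

Definition hlf : rat := 2^-1.

(** The central difference of [X^(j+1)] has degree [j], parity [j] and leading coefficient [j + 1],
    so these differences form a triangular family. *)
Lemma central_diff_onto d (Q : {poly rat}) : parpoly d Q ->
  exists2 P, parpoly d.+1 P & forall z : rat, P.[z + hlf] - P.[z - hlf] = Q.[z].
Proof.
pose g j := ('X + hlf%:P) ^+ j.+1 - ('X - hlf%:P) ^+ j.+1 : {poly rat}.
have Hg j : parpoly j (g j) /\ (g j)`_j = j.+1%:R.
  have [s [t [E1 E2 _ [Vt tj]]]] := parpoly_shift j.+1 hlf.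
  rewrite /g E1 E2 (_ : s + t - (s - t) = 2 *: t); last by rewrite scaler_nat; ring.
  split; first exact: parpolyZ.
  by rewrite coefZ tj mulrCA mulfV // mulr1.
move=> VQ; have [||c ->] := @parpoly_basis g _ _ _ _ VQ.
- by move=> j; case: (Hg j).
- by move=> j; case: (Hg j) => _ ->; rewrite pnatr_eq0.
exists (\sum_(j < d.+1 | odd j == odd d) c j *: 'X ^+ j.+1).
  apply: parpoly_sum => j /eqP jd; apply: parpolyZ.
  apply: (@parpolyW j.+1); rewrite /= ?jd ?ltn_ord //.
  elim: (j.+1) => [|k IH]; first by rewrite expr0; exact: parpolyC.
  by rewrite exprS -add1n; apply: parpolyM => //; exact: parpolyX.
move=> z; rewrite !horner_sum -sumrB; apply: eq_bigr => j _.
by rewrite /g hornerZ !hornerZ hornerXn hornerXn hornerD hornerN !horner_exp !hornerE mulrBr.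
Qed.

Lemma faulhaberS l r : faulhaber l r.+1 = faulhaber l r + (r.+1 ^ l.-1)%:R.
Proof. by rewrite /faulhaber big_nat_recr. Qed.

Lemma faulhaber0 l : faulhaber l 0 = 0.
Proof. by rewrite /faulhaber big_geq. Qed.

(** A central antidifference of [X^n], read at [r + 1/2], has the increments of the Faulhaber
    polynomial; the constant [c] adjusts the value at [r = 0]. *)
Lemma faulhaber_parpoly n : exists c (P : {poly rat}), parpoly n.+1 P /\
  forall r : nat, faulhaber n.+1 r = P.[r%:R + hlf] + c.
Proof.
have [|P VP HP] := @central_diff_onto n 'X^n.
  elim: n => [|k IH]; first by rewrite expr0; exact: parpolyC.
  by rewrite exprS -add1n; apply: parpolyM => //; exact: parpolyX.
exists (- P.[hlf]), P; split=> //; elim=> [|r IH].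
  by rewrite faulhaber0 add0r subrr.
rewrite faulhaberS IH /= natrX; have := HP r.+1%:R; rewrite hornerXn => <-.
have -> : r.+1%:R - hlf = r%:R + hlf.
  by apply/eqP; rewrite subr_eq -addrA -natr1 /hlf.
by rewrite addrC addrA subrK.
Qed.

Definition ev (i : nat) : {poly rat} -> Pfun := horner_alg (yvar i).
HB.instance Definition _ i := GRing.LRMorphism.on (ev i).

Lemma evX i : ev i 'X = yvar i. Proof. exact: horner_algX. Qed.
Lemma evC i c : ev i c%:P = c%:A. Proof. exact: horner_algC. Qed.

Lemma evZ i c P : ev i (c *: P) = c *: ev i P.
Proof. by rewrite -mul_polyC rmorphM /= evC mulr_algl. Qed.

(** The derivation of polynomials that becomes [theta i] when [X] is replaced by [yvar i]. *)
Definition dY (P : {poly rat}) : {poly rat} := P^`() * ('X^2 - (4^-1)%:P).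

Lemma theta_ev i P : theta i (ev i P) = ev i (dY P).
Proof.
elim/poly_ind: P => [|P c IH]; first by rewrite /dY deriv0 mul0r !raddf0.
rewrite /dY derivD derivM derivX derivC addr0 mulr1.
rewrite raddfD raddfD /= evC theta_const addr0 rmorphM thetaM IH /dY !rmorphM /= evX theta_yvar.
rewrite !rmorphD !rmorphM /= rmorphN /= ?rmorphXn /= evC evX; ring.
Qed.

Lemma theta_ev_neq i j P : i != j -> theta i (ev j P) = 0.
Proof.
move=> ij; elim/poly_ind: P => [|P c IH]; first by rewrite !raddf0.
by rewrite !raddfD /= evC theta_const rmorphM thetaM IH /= evX theta_yvar_neq // mul0r mulr0 !addr0.
Qed.

(** The polynomial in [y] that represents [theta^n (u / (1 - u))], that is, the sum of the [r^n u^r]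
    over [r > 0]. *)
Definition ph (n : nat) : {poly rat} := iter n dY ('X - hlf%:P).

Lemma ev_ph0 i : ev i (ph 0) = xvar i.
Proof. by rewrite /ph /= rmorphB /= evX evC /yvar addrK. Qed.

Lemma ev_phS i n : ev i (ph n.+1) = theta i (ev i (ph n)).
Proof. by rewrite theta_ev. Qed.

Lemma ev_phE i n l : ev i (ph n) l = if umono i l then (mlt i l)%:R ^+ n else 0.
Proof.
elim: n => [|n IH]; first by rewrite ev_ph0 /xvar; case: umono.
by rewrite ev_phS /theta /ppmul IH /rpow expr1; case: umono; rewrite ?mulr0 // -exprS.
Qed.

Lemma mlt_small i l : (psize l < i.+1)%N -> mlt i l = 0%N.
Proof. by case: (psingP i l) => // m ->; rewrite psize_join psize_psing; lia. Qed.

Lemma vanish_ev_ph i n : vanish i.+1 (ev i (ph n)).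
Proof. by move=> l /mlt_small il; rewrite ev_phE /umono il. Qed.

Definition fau (i n : nat) : Pfun := fun l => faulhaber n.+1 (mlt i l).

(** Multiplication by [1 - u] takes differences in the multiplicity [r], and the difference of the
    Faulhaber polynomial is [r^n]. *)
Lemma fauE i n : fau i n = ev i (ph n) * Z.
Proof.
apply: (pfun_regl (cou_nil i)).
pose w n : Pfun := fun l => if (0 < mlt i l)%N then (mlt i l)%:R ^+ n else 0.
have -> : cou i * fau i n = w n.
  apply: funext => l; rewrite couE /w.
  case: (psingP i l) => [m ->|il].
    rewrite uvarM_in /fau mlt_join mlt_psing eqxx add1n faulhaberS /= natrX.
    by rewrite addrC addKr.
  by rewrite uvarM_out // /fau il faulhaber0 subr0.
have w1 k : w k.+1 = theta i (w k).
  apply: funext => l; rewrite /w /theta /ppmul /rpow expr1.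
  by case: (mlt i l) => [|r]; rewrite ?mulr0 //= -exprS.
(* The series [(1 - u) Z] does not involve [u], so [theta i] passes through it. *)
have t0 : theta i (cou i * Z) = 0.
  by rewrite thetaM theta_cou eqxx theta_Z mulrA xvar_cou mulNr addNr.
elim: n => [|n IH].
  rewrite ev_ph0 mulrA xvar_cou; apply: funext => l; rewrite /w.
  by case: (psingP i l) => [m ->|il]; rewrite ?uvarM_in ?uvarM_out // expr0.
by rewrite w1 IH mulrCA thetaM t0 mulr0 addr0 -ev_phS mulrCA.
Qed.

(** * Differential operators summed over the part sizes *)

(** For a [summable] family the cut at [psize l] drops only zero terms, so this is the infinite sum
    over all part sizes. *)
Definition msum (k : nat) (A : nat -> Pfun) : Pfun :=
  fun l => \sum_(i < psize l) (i.+1 ^ k)%:R * A i l.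

Definition summable (A : nat -> Pfun) := forall i, vanish i.+1 (A i).

Lemma msumE k A N l : summable A -> (psize l <= N)%N ->
  msum k A l = (\sum_(i < N) (i.+1 ^ k)%:R *: A i : Pfun) l.
Proof.
move=> HA lN; rewrite sum_pfunE /msum -(subnKC lN) big_split_ord /=.
rewrite [X in _ + X]big1 ?addr0 // => i _.
by rewrite scalepE HA ?mulr0 // ltnS leq_addr.
Qed.

Lemma eq_msum k A B : (forall i, A i = B i) -> msum k A = msum k B.
Proof. by move=> AB; apply: funext => l; apply: eq_bigr => i _; rewrite AB. Qed.

Lemma msumD k A B : msum k (fun i => A i + B i) = msum k A + msum k B.
Proof.
apply: funext => l; rewrite addpE /msum -big_split.
by apply: eq_bigr => i _; rewrite addpE mulrDr.
Qed.

Lemma msumZ k c A : msum k (fun i => c *: A i) = c *: msum k A.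
Proof.
apply: funext => l; rewrite scalepE /msum mulr_sumr.
by apply: eq_bigr => i _; rewrite scalepE mulrCA.
Qed.

Lemma msum_weight k k' A :
  msum k (fun i => (i.+1 ^ k')%:R *: A i) = msum (k + k') A.
Proof.
apply: funext => l; apply: eq_bigr => i _.
by rewrite scalepE expnD natrM mulrA.
Qed.

Lemma msum_sum k (I : Type) (r : seq I) (P : pred I) (A : I -> nat -> Pfun) :
  msum k (fun i => \sum_(j <- r | P j) A j i) = \sum_(j <- r | P j) msum k (A j).
Proof.
apply: funext => l; rewrite sum_pfunE /msum exchange_big /=.
by apply: eq_bigr => i _; rewrite sum_pfunE mulr_sumr.
Qed.

Lemma ppmul_msum k A f : ppmul (msum k A) f = msum k (fun i => ppmul (A i) f).
Proof.
apply: funext => l; rewrite /ppmul /msum mulr_suml.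
by apply: eq_bigr => i _; rewrite mulrA.
Qed.

Lemma msum_vanish0 k A : msum k A pnil = 0.
Proof. by rewrite /msum big_ord0. Qed.

(* Linear maps that do not decrease the order of vanishing are continuous, so they
   commute with the infinite sums [msum]. *)
Lemma msum_lin k A (D : Pfun -> Pfun) :
  (forall f g, D (f + g) = D f + D g) -> (forall c f, D (c *: f) = c *: D f) ->
  (forall n f, vanish n f -> vanish n (D f)) -> summable A ->
  D (msum k A) = msum k (fun i => D (A i)).
Proof.
move=> DD DZ Dv HA; apply: funext => l; set N := psize l.
pose s : Pfun := \sum_(i < N) (i.+1 ^ k)%:R *: A i.
have Hs : vanish N.+1 (msum k A - s).
  by move=> m mN; rewrite subpE (msumE k HA (N := N)) ?subrr.
rewrite -[X in D X](subrK s) DD addpE (Dv _ _ Hs) // add0r.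
rewrite (@msumE _ _ N) //; last by move=> i; apply: Dv.
have D0 : D 0 = 0 by rewrite -(scale0r (0 : Pfun)) DZ scale0r.
rewrite /s (big_morph D DD D0) !sum_pfunE; apply: eq_bigr => i _.
by rewrite DZ.
Qed.

Lemma msumMr k A f : summable A -> msum k A * f = msum k (fun i => A i * f).
Proof.
apply: (@msum_lin k A (fun g => g * f)) => [g h|c g|n g].
- exact: mulrDl.
- by rewrite scalerAl.
- exact: vanishMr.
Qed.

Lemma msumMl k A f : summable A -> f * msum k A = msum k (fun i => f * A i).
Proof. by move=> HA; rewrite mulrC msumMr //; apply: eq_msum => i; rewrite mulrC. Qed.

Lemma msum_delta k i (f : Pfun) : vanish i.+1 f ->
  msum k (fun j => if j == i then f else 0) = (i.+1 ^ k)%:R *: f.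
Proof.
move=> fi; apply: funext => l; rewrite /msum scalepE.
case: (ltnP i (psize l)) => il.
  rewrite (bigD1 (Ordinal il)) //= eqxx big1 ?addr0 // => j ji.
  by rewrite (_ : (j == i :> nat) = false) ?mulr0 //; apply: negbTE.
rewrite fi // mulr0 big1 // => j _; case: eqP => [ji|_]; last by rewrite mulr0.
by move: (ltn_ord j); rewrite ji ltnNge il.
Qed.

(** The bracket of [T_{k,l}] up to a constant, with [l = n + 1]; this shift of the second index
    persists below. *)
Definition pp (k n : nat) : Pfun := msum k (fun i => ev i (ph n)).

(* [D i] is a differential operator in the variable [u_{i+1}], written in terms of
   [yvar i] and [theta i]; up to an additive constant it is of degree at most [d] and
   parity [d] for the grading in which both have degree [1]. *)
Record diffop (d : nat) (D : nat -> Pfun -> Pfun) : Prop := DiffOp {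
  diffopD : forall i f g, D i (f + g) = D i f + D i g;
  diffopZ : forall i c f, D i (c *: f) = c *: D i f;
  diffop_sum : forall i f, vanish i.+1 (D i f);
  diffop_cont : forall i n f, vanish n f -> vanish n (D i f);
  diffop_local : forall i j P f, i != j -> D i (ev j P * f) = ev j P * D i f;
  diffop_poly : exists c, forall e P, parpoly e P -> exists2 Q, parpoly (e + d) Q &
     forall i, D i (ev i P) = ev i Q + c *: ev i P }.

Definition commut (D : nat -> Pfun -> Pfun) (n : nat) (i : nat) (f : Pfun) : Pfun :=
  D i (ev i (ph n) * f) - ev i (ph n) * D i f.

Lemma parpoly_dY e P : parpoly e P -> parpoly e.+1 (dY P) /\ (dY P)`_e.+1 = e%:R * P`_e.
Proof.
case: e => [|e] [sP pP].
  move: sP => /size1_polyC ->; rewrite /dY derivC mul0r coef0 mul0r; split=> //.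
  exact: parpoly0.
have V2 : parpoly 2 ('X^2 - (4^-1)%:P).
  apply: parpolyB; first exact: (parpolyM parpolyX parpolyX).
  by apply: (@parpolyW 0) => //; exact: parpolyC.
split.
  rewrite /dY -addn2; apply: parpolyM => //; split.
    by apply/leq_sizeP => j ej; rewrite coef_deriv nth_default ?mul0rn // (leq_trans sP).
  by move=> k kd; rewrite coef_deriv pP ?mul0rn //= -!oddS; move: kd; rewrite /=; case: (odd k) (odd e) => [] [].
rewrite /dY mulrBr coefB coefMXn /= coefMC !coef_deriv /= subn2 /=.
by rewrite (nth_default _ (_ : size P <= e.+3)%N) ?mul0rn ?mul0r ?subr0 ?mulr_natl // (leq_trans sP).
Qed.

Lemma ph_parpoly n : parpoly n.+2 (ph n.+1) /\ (ph n.+1)`_n.+2 != 0.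
Proof.
elim: n => [|n [Vn cn]].
  have -> : ph 1 = dY 'X by rewrite /ph /= /dY derivB derivC subr0.
  by have [? ->] := parpoly_dY parpolyX; rewrite coefX.
have [? E] := parpoly_dY Vn; split=> //.
by rewrite [ph _]/(dY (ph n.+1)) E mulf_neq0 // pnatr_eq0.
Qed.

(** For [n = 0] the constant -1/2 of [ph 0] breaks the parity. It is split off because it cancels in
    commutators. *)
Lemma ph_split n : exists g G, parpoly n.+1 G /\ ph n = G + g%:P.
Proof.
case: n => [|n]; last by exists 0, (ph n.+1); rewrite addr0; case: (ph_parpoly n).
by exists (- hlf), 'X; rewrite polyCN; split=> //; exact: parpolyX.
Qed.

(** Both the scalar [c] of [D] and the constant term split off from [ph n] cancel in the commutator.
    What remains has exact parity, so the new scalar is 0. *)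
Lemma diffop_commut d D n : diffop d D -> diffop (d + n.+1) (commut D n).
Proof.
case=> DD DZ Ds Dc Dl [c Dp]; split.
- by move=> i f g; rewrite /commut !DD mulrDr !DD mulrDr; ring.
- move=> i a f; rewrite /commut DZ -!scalerAr DZ scalerBr; congr (_ - _).
- by move=> i f l li; rewrite /commut subpE Ds // (vanishMl _ (Ds i f)) // subrr.
- move=> i m f fm l lm; rewrite /commut subpE (Dc _ m) ?(vanishMl _ (Dc i m f fm)) ?subrr //.
  exact: vanishMl.
- by move=> i j P f ij; rewrite /commut mulrCA !(Dl i j) // mulrBr; congr (_ - _); exact: mulrCA.
exists 0 => e P VP; have [g [G [VG phE]]] := ph_split n.
have [Q VQ HQ] := Dp _ _ VP; have [Q1 VQ1 HQ1] := Dp _ _ (parpolyM VP VG).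
exists (Q1 - G * Q).
  apply: parpolyB; first by rewrite addnA addnAC.
  by rewrite addnA [X in parpoly X _]addnC; apply: parpolyM.
move=> i; rewrite scale0r addr0 /commut -rmorphM /= phE.
have -> : ev i ((G + g%:P) * P) = ev i (P * G) + g *: ev i P.
  by rewrite mulrDl raddfD /= mul_polyC evZ [G * P]mulrC.
rewrite DD DZ HQ1 HQ rmorphD /= evC (mulrDl (ev i G)) mulr_algl rmorphB !rmorphM /=.
rewrite opprD addrACA subrr addr0 mulrDr -scalerAr opprD addrACA.
by rewrite [ev i G * ev i P]mulrC subrr addr0.
Qed.

Definition dsum (k : nat) (D : nat -> Pfun -> Pfun) (f : Pfun) : Pfun :=
  msum k (fun i => D i f).

(** In the double sum over [i] and [j] the operator [D i] commutes with the factor in the variable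
    [j] unless [i = j]. On the diagonal the weights multiply to [(i+1)^(k+k')]. *)
Lemma dsum_mul d D k k' n f : diffop d D ->
  dsum k D (pp k' n * f) = pp k' n * dsum k D f + dsum (k + k') (commut D n) f.
Proof.
move=> Hop; case: (Hop) => DD DZ Ds Dc Dl Dp.
have Hs : summable (fun i => ev i (ph n)) by move=> i; exact: vanish_ev_ph.
rewrite /dsum -(msum_weight k k') msumMl // -msumD; apply: eq_msum => i.
rewrite /pp msumMr // (msum_lin k' (DD i) (DZ i) (Dc i)) //; last by move=> j; apply: vanishMr.
(* The diagonal commutator is written as a sum over [j] supported at [j = i], and the two sides are
   compared termwise. *)
rewrite msumMr // -msum_delta; last by have [_ _ + _ _ _] := diffop_commut n Hop; apply.
rewrite -msumD; apply: eq_msum => j.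
case: eqVneq => [->|ji]; first by rewrite /commut addrC subrK.
by rewrite addr0 Dl // eq_sym.
Qed.

(** Each [D i 1] is one fixed polynomial in [yvar i], up to a constant, and it vanishes at the empty
    partition; it is therefore a combination of the [ph j]. *)
Lemma dsum_1 d D k : diffop d D -> exists c : nat -> rat,
  dsum k D 1 = \sum_(j < d | odd j.+1 == odd d) c j *: pp k j.
Proof.
case=> DD DZ Ds Dc Dl [c0 Dp].
have [Q VQ HQ] := Dp 0%N 1 (parpolyC 1).
(* The basis [1, X, ph 1, ph 2, ...] has degrees [0, 1, 2, 3, ...]; [X] replaces [ph 0 = X - 1/2],
   which has no parity. *)
pose g j := if j is m.+1 then if m is m'.+1 then ph m else 'X else 1.
have [||c HQc] := @parpoly_basis g _ _ _ _ VQ.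
- by case=> [|[|j]] /=; [exact: (parpolyC 1)|exact: parpolyX|case: (ph_parpoly j)].
- by case=> [|[|j]] /=; rewrite ?coef1 ?coefX //; case: (ph_parpoly j).
rewrite add0n in HQc.
have [a Ha] : exists a, Q = \sum_(j < d | odd j.+1 == odd d) c j.+1 *: ph j + a%:P.
  rewrite HQc; suff H m : exists a, \sum_(j < m.+1 | odd j == odd d) c j *: g j =
    \sum_(j < m | odd j.+1 == odd d) c j.+1 *: ph j + a%:P by exact: H.
  elim: m => [|m [a IH]].
    rewrite big_mkcond big_ord1 big_ord0 /=; case: ifP => _; last by exists 0; rewrite addr0.
    by exists (c 0%N); rewrite add0r alg_polyC.
  rewrite big_mkcond big_ord_recr -big_mkcond IH.
  have Hg : exists b, g m.+1 = ph m + b%:P.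
    by case: m {IH} => [|m]; [exists hlf; rewrite /ph /= subrK | exists 0; rewrite addr0].
  case: Hg => b Hb; exists (a + (if odd m.+1 == odd d then c m.+1 * b else 0)).
  rewrite [in RHS]big_mkcond [in RHS]big_ord_recr /= -big_mkcond -!addrA; congr (_ + _).
  rewrite -/(g m.+1) Hb; case: ifP => _; last by rewrite add0r !addr0.
  by rewrite scalerDr addrCA; congr (_ + _); rewrite -mul_polyC -polyCM polyCD.
exists (fun j => c j.+1).
have E i : D i 1 = \sum_(j < d | odd j.+1 == odd d) c j.+1 *: ev i (ph j) + (a + c0)%:A.
  have := HQ i; rewrite rmorph1 => ->; rewrite Ha raddfD raddf_sum /= evC.
  under eq_bigr => j _ do rewrite evZ.
  by rewrite -addrA -scalerDl.
(* At the empty partition all terms vanish except the constant. *)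
have a0 : a + c0 = 0.
  have := Ds 0%N 1 pnil isT; rewrite E addpE sum_pfunE big1 ?add0r => [|j _].
    by rewrite scalepE onepE eqxx mulr1.
  by rewrite scalepE vanish_ev_ph ?mulr0.
rewrite /dsum (eq_msum _ E) a0.
under [X in msum k X]funext => i do rewrite scale0r addr0.
by rewrite msum_sum; apply: eq_bigr => j _; rewrite msumZ.
Qed.

(** * Closure under the pointwise product *)

(** The operator [theta + 1/2] conjugated by [Z], by [theta_Z]. *)
Definition Yop (i : nat) (f : Pfun) : Pfun := theta i f + yvar i * f.

Lemma Yop_Z i f : theta i (f * Z) + hlf *: (f * Z) = Yop i f * Z.
Proof.
rewrite thetaM theta_Z /Yop /yvar -/hlf mulrDl mulrDl mulr_algl mulrDl -scalerAl.
by rewrite -!addrA mulrA [f * xvar i]mulrC.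
Qed.

Lemma Yop_ev i P : Yop i (ev i P) = ev i (dY P + 'X * P).
Proof. by rewrite /Yop theta_ev rmorphD rmorphM /= evX. Qed.

Lemma Yop_local i j P f : i != j -> Yop i (ev j P * f) = ev j P * Yop i f.
Proof. by move=> ij; rewrite /Yop thetaM theta_ev_neq // mul0r add0r mulrCA -mulrDr. Qed.

Lemma iter_Yop_ev k e P : parpoly e P ->
  exists2 Q, parpoly (e + k) Q & forall i, iter k (Yop i) (ev i P) = ev i Q.
Proof.
move=> VP; elim: k => [|k [Q VQ HQ]]; first by exists P; rewrite ?addn0.
exists (dY Q + 'X * Q); last by move=> j; rewrite iterS HQ Yop_ev.
rewrite addnS; apply: parpolyD; first by case: (parpoly_dY VQ).
by rewrite -add1n; apply: parpolyM => //; exact: parpolyX.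
Qed.

(** Pointwise multiplication by the Faulhaber polynomial of one multiplicity, conjugated by [Z] so
    as to act on brackets. *)
Definition Fop (n i : nat) (f : Pfun) : Pfun := Zi * ppmul (fau i n) (f * Z).

(** On monomials [theta i + 1/2] acts as the scalar [r + 1/2], and the Faulhaber polynomial is, up
    to [c], a polynomial of parity [n + 1] in it. *)
Lemma FopE n : exists c (P : {poly rat}), parpoly n.+1 P /\ forall i f,
  Fop n i f = \sum_(k < size P) P`_k *: iter k (Yop i) f + c *: f.
Proof.
have [c [P [VP HP]]] := faulhaber_parpoly n.
exists c, P; split=> // i f.
have E k : iter k (Yop i) f * Z = ppmul (fun l => ((mlt i l)%:R + hlf) ^+ k) (f * Z).
  elim: k => [|k IH]; first by apply: funext => l; rewrite /ppmul expr0 mul1r.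
  rewrite iterS -Yop_Z IH; apply: funext => l.
  by rewrite addpE scalepE /theta /ppmul /rpow expr1 -mulrDl exprS mulrA.
apply: (@pfun_regl Z) => //; rewrite /Fop mulrA ZK mul1r [Z * _]mulrC mulrDl mulr_suml -scalerAl.
under eq_bigr => k _ do rewrite -scalerAl E.
apply: funext => l; rewrite addpE sum_pfunE scalepE /ppmul /fau HP horner_coef.
rewrite mulrDl mulr_suml; congr (_ + _); apply: eq_bigr => k _.
by rewrite scalepE mulrA.
Qed.

(** Linearity, summability and continuity are visible on coefficients; locality and parity come from
    the expression in [Yop]. *)
Lemma diffop_Fop n : diffop n.+1 (Fop n).
Proof.
split.
- by move=> i f g; rewrite /Fop mulrDl ppmulD mulrDr.
- by move=> i c f; rewrite /Fop -scalerAl ppmulZ -scalerAr.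
- move=> i f; rewrite /Fop; apply: vanishMl => l /mlt_small il.
  by rewrite /ppmul /fau il faulhaber0 mul0r.
- move=> i m f fm; rewrite /Fop; apply: vanishMl => l lm.
  by rewrite /ppmul (vanishMr _ fm) ?mulr0.
- move=> i j P f ij; have [c [Q [_ HQ]]] := FopE n.
  rewrite !HQ mulrDr -scalerAr mulr_sumr; congr (_ + _); apply: eq_bigr => k _.
  rewrite -scalerAr; congr (_ *: _); elim: (val k) => [//|m IH].
  by rewrite !iterS IH Yop_local.
have [c [Q [VQ HQ]]] := FopE n; exists c => e P VP.
have H k := cid2 (iter_Yop_ev k VP).
exists (\sum_(k < size Q) Q`_k *: s2val (H k)).
  apply: parpoly_sum => k _.
  case: (boolP (odd k == odd n.+1)) => [/eqP kn|kn]; last first.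
    by case: VQ => _ ->; rewrite ?scale0r //; exact: parpoly0.
  apply: parpolyZ; apply: (@parpolyW (e + k)); last exact: s2valP.
    by rewrite leq_add2l -ltnS; case: VQ => sQ _; apply: leq_trans sQ.
  by rewrite !oddD kn.
move=> i; rewrite HQ raddf_sum /=; congr (_ + _); apply: eq_bigr => k _.
by rewrite evZ (s2valP' (H k)).
Qed.

Definition tfun (k n : nat) : Pfun := msum k (fun i => fau i n).

Lemma summable_ph n : summable (fun i => ev i (ph n)).
Proof. by move=> i; exact: vanish_ev_ph. Qed.

Lemma tfunE k n : tfun k n = pp k n * Z.
Proof.
rewrite /pp msumMr; last exact: summable_ph.
by apply: eq_msum => i; rewrite fauE.
Qed.

Lemma dsum_Fop k n f : ppmul (tfun k n) (f * Z) = dsum k (Fop n) f * Z.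
Proof.
have [_ _ s _ _ _] := diffop_Fop n.
rewrite /dsum msumMr; last by move=> i; exact: s.
rewrite /tfun ppmul_msum; apply: eq_msum => i.
by rewrite /Fop [RHS]mulrC mulrA ZK mul1r.
Qed.

Lemma dsum_Fop1 k n : dsum k (Fop n) 1 = pp k n.
Proof.
apply: (@pfun_regl Z) => //; rewrite [LHS]mulrC [RHS]mulrC -dsum_Fop mul1r ppmulf1.
exact: tfunE.
Qed.

(** The index [n] bounds the number of factors, so this is a filtration and not a grading. The set
    [K] constrains the pairs [(k, l)] with [l = j + 1]. *)
Inductive prods (K : nat -> nat -> Prop) : nat -> Pfun -> Prop :=
| prods1 n : prods K n 1
| prodsM n k j f : K k j.+1 -> prods K n f -> prods K n.+1 (pp k j * f)
| prodsD n f g : prods K n f -> prods K n g -> prods K n (f + g)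
| prodsZ n c f : prods K n f -> prods K n (c *: f).

Lemma prods0 K n : prods K n 0.
Proof. by rewrite -(scale0r (1 : Pfun)); apply: prodsZ; exact: prods1. Qed.

Lemma prods_sum K n (I : Type) (r : seq I) (A : pred I) (F : I -> Pfun) :
  (forall i, A i -> prods K n (F i)) -> prods K n (\sum_(i <- r | A i) F i).
Proof. by move=> H; apply: big_ind => //; [exact: prods0 | exact: prodsD]. Qed.

Lemma prodsS K n f : prods K n f -> prods K n.+1 f.
Proof.
elim=> {n f} [n|n k j f Kkj _ IH|n f g _ Hf _ Hg|n c f _ IH].
- exact: prods1.
- exact: prodsM.
- exact: prodsD.
- exact: prodsZ.
Qed.

Lemma prodsW K n m f : (n <= m)%N -> prods K n f -> prods K m f.
Proof. by move/subnKC <-; elim: (m - n)%N => [|k IH]; rewrite ?addn0 // addnS => /IH /prodsS. Qed.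

Lemma prods_mul K n m f g : prods K n f -> prods K m g -> prods K (n + m) (f * g).
Proof.
move=> Hf Hg; elim: Hf => {n f} [n|n k j f Kkj _ IH|n f f' _ Hf _ Hf'|n c f _ IH].
- by rewrite mul1r; apply: prodsW Hg; exact: leq_addl.
- by rewrite -mulrA; exact: prodsM.
- by rewrite mulrDl; exact: prodsD.
- by rewrite -scalerAl; exact: prodsZ.
Qed.

Lemma prods_pp K k j : K k j.+1 -> prods K 1 (pp k j).
Proof. by move=> Kkj; rewrite -[pp k j]mulr1; apply: prodsM => //; exact: prods1. Qed.

(** The first condition allows commutators, whose indices add by [dsum_mul]; the second allows the
    expansion of [dsum k D 1] in [dsum_1]. *)
Definition admissible (K : nat -> nat -> Prop) :=
  (forall k l k' l', K k l -> K k' l' -> K (k + k')%N (l + l')%N) /\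
  (forall k l j, K k l -> (0 < j <= l)%N -> odd j = odd l -> K k j).

(** Moving the operator past the factors leaves commutators, each of which absorbs a factor, so no
    more than [n] factors remain. The induction covers all operators at once because commutators are
    new ones. *)
Lemma prods_dsum K n f : admissible K -> prods K n f ->
  forall k d D, diffop d D -> K k d ->
  prods K n (dsum k D f - dsum k D 1 * f).
Proof.
move=> [KD Kle]; elim=> {n f} [n|n k j f Kkj Hf IH|n f g _ Hf _ Hg|n c f _ IH] k' d D HD Kd.
- by rewrite mulr1 subrr; exact: prods0.
- rewrite (dsum_mul _ _ _ _ HD).
  have HC := diffop_commut j HD; have KC := KD _ _ _ _ Kd Kkj.
  have -> : pp k j * dsum k' D f + dsum (k' + k) (commut D j) f - dsum k' D 1 * (pp k j * f) =
    pp k j * (dsum k' D f - dsum k' D 1 * f) +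
    (dsum (k' + k) (commut D j) f - dsum (k' + k) (commut D j) 1 * f) +
    dsum (k' + k) (commut D j) 1 * f by ring.
  apply: prodsD; first apply: prodsD.
  + by apply: prodsM => //; exact: IH HD Kd.
  + by apply: prodsS; apply: IH HC _.
  rewrite -add1n; apply: prods_mul => //.
  have [c ->] := dsum_1 (k' + k) HC; apply: prods_sum => i /eqP id.
  apply: prodsZ; apply: prods_pp; apply: Kle KC _ id.
  by rewrite ltn_ord.
- have -> : dsum k' D (f + g) = dsum k' D f + dsum k' D g.
    by rewrite /dsum -msumD; apply: eq_msum => i; rewrite (diffopD HD).
  by rewrite mulrDr opprD addrACA; apply: prodsD; [exact: Hf HD Kd|exact: Hg HD Kd].
have -> : dsum k' D (c *: f) = c *: dsum k' D f.
  by rewrite /dsum -msumZ; apply: eq_msum => i; rewrite (diffopZ HD).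
by rewrite -scalerAr -scalerBr; apply: prodsZ; exact: IH HD Kd.
Qed.

(* Pointwise multiplication by a double moment function is, to leading order, its
   induced product. *)
Lemma ppmul_tfun K n f k j : admissible K -> K k j.+1 -> prods K n f ->
  exists2 R, prods K n R & ppmul (tfun k j) (f * Z) = (pp k j * f + R) * Z.
Proof.
move=> HK Kkj Hf; exists (dsum k (Fop j) f - dsum k (Fop j) 1 * f).
  exact: (prods_dsum HK Hf (diffop_Fop j)).
by rewrite dsum_Fop dsum_Fop1 addrC subrK.
Qed.

(** [f = H * Z] says that [H] is the u-bracket of [f]. *)
Definition indalg (K : nat -> nat -> Prop) (f : Pfun) : Prop :=
  exists n H, prods K n H /\ f = H * Z.

Lemma indalgD K f g : indalg K f -> indalg K g -> indalg K (f + g).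
Proof.
move=> [n [F [HF ->]]] [m [G [HG ->]]]; exists (n + m)%N, (F + G); rewrite mulrDl; split=> //.
by apply: prodsD; [apply: prodsW HF; exact: leq_addr|apply: prodsW HG; exact: leq_addl].
Qed.

Lemma indalgZ K c f : indalg K f -> indalg K (c *: f).
Proof. by move=> [n [F [HF ->]]]; exists n, (c *: F); rewrite scalerAl; split=> //; exact: prodsZ. Qed.

Lemma indalg_ppmul_tfun K k j g : admissible K -> K k j.+1 -> indalg K g ->
  indalg K (ppmul (tfun k j) g).
Proof.
move=> HK Kkj [n [G [HG ->]]]; have [R HR ->] := ppmul_tfun HK Kkj HG.
exists n.+1, (pp k j * G + R); split=> //.
by apply: prodsD; [exact: prodsM|exact: prodsS].
Qed.

(** By [ppmul_tfun], an induced product with [tfun k j] is the pointwise one minus a correction [R]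
    with fewer factors. Pointwise products associate, and induction on the number of factors
    disposes of [R]. *)
Lemma indalg_ppmul K f g : admissible K -> indalg K f -> indalg K g -> indalg K (ppmul f g).
Proof.
move=> HK [n [F [HF ->]]]; elim/ltn_ind: n F HF g => n IH F HF.
elim: HF IH => {n F} [n|n k j F Kkj HF IHF|n F G HF IHF HG IHG|n c F HF IHF] IH g Hg.
- by rewrite mul1r ppmul1.
- have [R HR E] := ppmul_tfun HK Kkj HF.
  have -> : pp k j * F * Z = ppmul (tfun k j) (F * Z) - R * Z.
    by rewrite E mulrDl addrK.
  rewrite -scaleN1r ppmulDl ppmulZl -ppmulA; apply: indalgD.
    by apply: indalg_ppmul_tfun => //; exact: (IH n (ltnSn n) _ HF).
  by apply: indalgZ; exact: (IH n (ltnSn n) _ HR).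
- by rewrite mulrDl ppmulDl; apply: indalgD; [exact: IHF|exact: IHG].
- by rewrite -scalerAl ppmulZl; apply: indalgZ; exact: IHF.
Qed.

(** * The algebras S, Sym(S) and T *)

Definition Tidx (k l : nat) : Prop := (1 <= l)%N /\ ~~ odd (k + l).
(** The pairs reached from [(a, 1)], [a] odd, by repeated steps [(1, 1)]; see [SymS_tfun]. *)
Definition Sidx (k l : nat) : Prop := (1 <= l <= k)%N /\ ~~ odd (k + l).

Lemma Tidx_admissible : admissible Tidx.
Proof.
split=> [k l k' l' [l0 kl] [l0' kl']|k l j [l0 kl] /andP[j0 jl] oj]; split => //.
- by rewrite addn_gt0 l0.
- by rewrite addnACA oddD (negbTE kl) (negbTE kl').
- by rewrite oddD oj -oddD.
Qed.

Lemma Sidx_admissible : admissible Sidx.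
Proof.
split=> [k l k' l' [/andP[l0 lk] kl] [/andP[l0' lk'] kl']|k l j [/andP[l0 lk] kl] /andP[j0 jl] oj]; split.
- by rewrite addn_gt0 l0 leq_add.
- by rewrite addnACA oddD (negbTE kl) (negbTE kl').
- by rewrite j0 (leq_trans jl).
- by rewrite oddD oj -oddD.
Qed.

Definition Tcst (k l : nat) : rat :=
  - bern (k + l) / (2 * (k + l))%:R * ((l == 1%N)%:R + (k == 0%N)%:R).

Lemma TmomE k n : Tmom k n.+1 = Tcst k n.+1 *: Z + tfun k n.
Proof.
apply: funext => l; rewrite addpE scalepE /pone mulr1 /Tmom; congr (_ + _).
by rewrite big_add1 big_mkord.
Qed.

Lemma fau0 i : fau i 0 = rpow i 1.
Proof.
apply: funext => l; rewrite /fau /rpow expr1.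
by elim: (mlt i l) => [|r IH]; rewrite ?faulhaber0 // faulhaberS IH natr1.
Qed.

Lemma tfun0_seq k l : tfun k 0 l = \sum_(x <- val l) (x ^ k)%:R.
Proof.
have H (s : seq nat) : all (fun x => (0 < x)%N) s -> forall N, (sumn s <= N)%N ->
    \sum_(i < N) (i.+1 ^ k)%:R * (count_mem i.+1 s)%:R = \sum_(x <- s) (x ^ k)%:R :> rat.
  elim: s => [|x s IH] /=; first by move=> _ N _; rewrite big_nil big1 // => i _; rewrite mulr0.
  move=> /andP[x0 /IH {}IH] N sN; rewrite big_cons -(IH N); last by lia.
  under eq_bigr => i _ do rewrite natrD mulrDr.
  rewrite big_split /=; congr (_ + _); case: x x0 sN => // x _ sN.
  have xN : (x < N)%N by lia.
  rewrite (bigD1 (Ordinal xN)) //= eqxx mulr1 big1 ?addr0 // => i ix.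
  by move: ix; rewrite -val_eqE eqSS eq_sym /= => /negbTE ->; rewrite mulr0.
rewrite -(H _ (part_pos l) (psize l)) //; apply: eq_bigr => i _.
by rewrite fau0 /rpow expr1.
Qed.

Lemma SmomE k : ~~ odd k -> (2 <= k)%N ->
  Smom k = (- bern k / (2 * k)%:R) *: Z + tfun k.-1 0.
Proof.
move=> _ _; apply: funext => l.
by rewrite addpE scalepE /pone mulr1 /Smom tfun0_seq.
Qed.

Lemma additive_tfun0 k : additive_on (tfun k 0).
Proof.
by move=> l m; rewrite !tfun0_seq (perm_big _ (perm_join l m)) big_cat.
Qed.

(** Pointwise multiplication by [tfun a 0] is the sum of the [m^a theta_m], and only the Euler
    operator of the variable at hand acts. *)
Lemma ppmul_tfun0_pp a k j : ppmul (tfun a 0) (pp k j) = pp (k + a) j.+1.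
Proof.
rewrite ppmulC /pp ppmul_msum -msum_weight; apply: eq_msum => i.
rewrite ppmulC /tfun ppmul_msum -msum_delta; last exact: vanish_ev_ph.
apply: eq_msum => i'; rewrite fau0 -/(theta i' _).
by case: eqVneq => [->|ii]; rewrite ?ev_phS // theta_ev_neq.
Qed.

(* As a function of [l], [tfun a 0] is additive, so pointwise multiplication by it is
   a derivation. *)
Lemma ppmul_tfun0 a f :
  ppmul (tfun a 0) (f * Z) = (ppmul (tfun a 0) f + pp a 0 * f) * Z.
Proof.
rewrite (ppmul_leibniz _ _ (additive_tfun0 a)) ppmulf1 tfunE; ring.
Qed.

Lemma indalg_tfun K k n : K k n.+1 -> indalg K (tfun k n).
Proof. by move=> Kkn; exists 1%N, (pp k n); rewrite tfunE; split=> //; exact: prods_pp. Qed.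

Lemma indalg_Z K : indalg K Z.
Proof. by exists 0%N, 1; rewrite mul1r; split=> //; exact: prods1. Qed.

Lemma Talg_indalg f : Talg f -> indalg Tidx f.
Proof.
elim=> {f} [|k [//|n] _ kl|f g _ Hf _ Hg|c f _ Hf|f g _ Hf _ Hg].
- exact: indalg_Z.
- rewrite TmomE; apply: indalgD; first by apply: indalgZ; exact: indalg_Z.
  exact: indalg_tfun.
- exact: indalgD.
- exact: indalgZ.
- exact: (indalg_ppmul Tidx_admissible).
Qed.

Lemma TalgB f g : Talg f -> Talg g -> Talg (f - g).
Proof. by move=> Hf Hg; rewrite -scaleN1r; apply: TalgD => //; apply: TalgZ. Qed.

Lemma Talg_tfun k n : Tidx k n.+1 -> Talg (tfun k n).
Proof.
move=> [_ kn]; have -> : tfun k n = Tmom k n.+1 - Tcst k n.+1 *: Z.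
  by rewrite TmomE addrC addKr.
by apply: TalgB; [exact: TalgT | apply: TalgZ; exact: Talg1].
Qed.

(** The triangularity used for [indalg_ppmul], read in the other direction: a pointwise product
    minus a correction with fewer factors. *)
Lemma indalg_Talg f : indalg Tidx f -> Talg f.
Proof.
move=> [n [F [HF ->]]]; elim/ltn_ind: n F HF => n IH F HF.
elim: HF IH => {n F} [n|n k j F Kkj HF IHF|n F G HF IHF HG IHG|n c F HF IHF] IH.
- by rewrite mul1r; exact: Talg1.
- have [R HR E] := ppmul_tfun Tidx_admissible Kkj HF.
  have -> : pp k j * F * Z = ppmul (tfun k j) (F * Z) - R * Z by rewrite E mulrDl addrK.
  apply: TalgB; last exact: (IH n (ltnSn n)).
  by apply: TalgM; [exact: Talg_tfun | exact: (IH n (ltnSn n))].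
- by rewrite mulrDl; apply: TalgD; [exact: IHF | exact: IHG].
- by rewrite -scalerAl; apply: TalgZ; exact: IHF.
Qed.

Definition odot (f g : Pfun) : Pfun := f * g * Zi.

Lemma odot_isP f g h : odot_is f g h <-> h = odot f g.
Proof.
rewrite odotE /odot; split=> [<-|->]; first by rewrite -mulrA ZK mulr1.
by rewrite -mulrA ZiK mulr1.
Qed.

Lemma odotZ F G : odot (F * Z) (G * Z) = F * G * Z.
Proof.
rewrite /odot -[RHS]mulr1 -ZK; ring.
Qed.

Lemma indalg_odot K f g : indalg K f -> indalg K g -> indalg K (odot f g).
Proof.
move=> [n [F [HF ->]]] [m [G [HG ->]]]; rewrite odotZ.
by exists (n + m)%N, (F * G); split=> //; exact: prods_mul.
Qed.

Lemma Salg_indalg f : Salg f -> indalg Sidx f.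
Proof.
elim=> {f} [|k ek k2|f g _ Hf _ Hg|c f _ Hf|f g _ Hf _ Hg].
- exact: indalg_Z.
- rewrite SmomE //; apply: indalgD; first by apply: indalgZ; exact: indalg_Z.
  by apply: indalg_tfun; case: k ek k2 => [|[|k]] //= ek _; split; rewrite ?addn1.
- exact: indalgD.
- exact: indalgZ.
- exact: (indalg_ppmul Sidx_admissible).
Qed.

Lemma SymS_indalg f : SymS f -> indalg Sidx f.
Proof.
elim=> {f} [f|f g _ Hf _ Hg|c f _ Hf|f g h _ Hf _ Hg /odot_isP ->].
- exact: Salg_indalg.
- exact: indalgD.
- exact: indalgZ.
- exact: indalg_odot.
Qed.

Lemma SymSB f g : SymS f -> SymS g -> SymS (f - g).
Proof. by move=> Hf Hg; rewrite -scaleN1r; apply: SymSD => //; apply: SymSZ. Qed.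

Lemma SymS_odot f g : SymS f -> SymS g -> SymS (odot f g).
Proof. by move=> Hf Hg; apply: (SymSO Hf Hg); apply/odot_isP. Qed.

Lemma Salg_tfun k : odd k -> Salg (tfun k 0).
Proof.
move=> ok; have -> : tfun k 0 = Smom k.+1 + (bern k.+1 / (2 * k.+1)%:R) *: Z.
  by rewrite SmomE ?negbK //; [rewrite addrAC mulNr scaleNr addNr add0r | case: k ok].
apply: SalgD; last by apply: SalgZ; exact: Salg1.
by apply: SalgS; rewrite /= ?negbK //; case: k ok.
Qed.

(** For an induced product [h] of [f] and [g] this is the quotient rule: the derivation is applied
    to [h * Z = f * g], and its value at [Z] is [tfun a 0] itself. *)
Lemma SymS_ppmul_tfun0 a f : odd a -> SymS f -> SymS (ppmul (tfun a 0) f).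
Proof.
move=> oa; elim=> {f} [f Hf|f g _ Hf _ Hg|c f _ Hf|f g h Hf Hf' Hg Hg' /odot_isP E].
- by apply: SymS_S; apply: SalgM => //; exact: Salg_tfun.
- by rewrite ppmulD; exact: SymSD.
- by rewrite ppmulZ; exact: SymSZ.
have t := SymS_S (Salg_tfun oa).
have -> : ppmul (tfun a 0) h =
    odot (ppmul (tfun a 0) f) g + odot f (ppmul (tfun a 0) g) - odot h (tfun a 0).
  have L := @ppmul_leibniz _ _ _ (additive_tfun0 a).
  apply: (@pfun_regl Z) => //.
  have /(congr1 (ppmul (tfun a 0))) : h * Z = f * g by rewrite E /odot -mulrA ZiK mulr1.
  have ZO u v : Z * odot u v = u * v by rewrite /odot mulrCA ZK mulr1.
  rewrite !L ppmulf1 => /(canRL (addrK _)).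
  by rewrite mulrBr mulrDr !ZO => <-; exact: mulrC.
have Hh : SymS h by apply: (SymSO Hf Hg); apply/odot_isP.
by apply: SymSB; [apply: SymSD|]; apply: SymS_odot.
Qed.

(** The derivation attached to [tfun 1 0] raises both indices of [pp] by one, and it is the
    difference of the pointwise and the induced product with [tfun 1 0]. *)
Lemma SymS_tfun k j : Sidx k j.+1 -> SymS (tfun k j).
Proof.
elim: j k => [|j IH] k [jk ok].
  by apply: SymS_S; apply: Salg_tfun; move: ok; rewrite addn1 /= negbK.
case: k jk ok => // k jk ok.
have Hk : SymS (tfun k j) by apply: IH; split; [exact: jk | move: ok; rewrite addSnnS !addnS /= !negbK].
have -> : tfun k.+1 j.+1 = ppmul (tfun 1 0) (tfun k j) - odot (tfun 1 0) (tfun k j).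
  by rewrite !tfunE odotZ -[X in ppmul X]tfunE ppmul_tfun0 ppmul_tfun0_pp mulrDl addrK addn1.
apply: SymSB; first exact: SymS_ppmul_tfun0.
by apply: SymS_odot => //; apply: SymS_S; exact: Salg_tfun.
Qed.

Lemma indalg_SymS f : indalg Sidx f -> SymS f.
Proof.
move=> [n [F [HF ->]]].
elim: HF => {n F} [n|n k j F Kkj HF IHF|n F G HF IHF HG IHG|n c F HF IHF].
- by rewrite mul1r; apply: SymS_S; exact: Salg1.
- by rewrite -odotZ; apply: SymS_odot => //; rewrite -tfunE; exact: SymS_tfun.
- by rewrite mulrDl; apply: SymSD.
- by rewrite -scalerAl; apply: SymSZ.
Qed.

Lemma SymS_pointwise : closed_pointwise SymS.
Proof.
move=> f g /SymS_indalg Hf /SymS_indalg Hg; apply: indalg_SymS.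
exact: indalg_ppmul Sidx_admissible Hf Hg.
Qed.

Lemma SymS_induced : closed_induced SymS.
Proof.
move=> f g Hf Hg; exists (odot f g); split; first by apply/odot_isP.
exact: SymS_odot.
Qed.

Lemma Talg_induced : closed_induced Talg.
Proof.
move=> f g /Talg_indalg Hf /Talg_indalg Hg; exists (odot f g); split; first by apply/odot_isP.
by apply: indalg_Talg; exact: indalg_odot.
Qed.

Lemma prodsK (K K' : nat -> nat -> Prop) n f : (forall k l, K k l -> K' k l) ->
  prods K n f -> prods K' n f.
Proof.
move=> KK; elim=> {n f} [n|n k j F Kkj _ ?|n F G _ ? _ ?|n c F _ ?].
- exact: prods1.
- by apply: prodsM => //; exact: KK.
- exact: prodsD.
- exact: prodsZ.
Qed.

Lemma SymS_Talg f : SymS f -> Talg f.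
Proof.
move=> /SymS_indalg [n [F [HF ->]]]; apply: indalg_Talg; exists n, F; split=> //.
by apply: prodsK HF => k l [/andP[]].
Qed.

(** * Strictness of the inclusions *)

Lemma poly_nat_eq (p q : {poly rat}) :
  (forall n : nat, p.[n.+1%:R] = q.[n.+1%:R]) -> p = q.
Proof.
move=> H; apply/eqP; rewrite -subr_eq0; apply/eqP.
pose rs : seq rat := [seq i.+1%:R | i <- iota 0 (size (p - q))].
apply: (@roots_geq_poly_eq0 _ _ rs).
- by apply/allP => x /mapP[i _ ->]; rewrite /root hornerD hornerN H subrr.
- by rewrite map_inj_uniq ?iota_uniq // => i j /eqP; rewrite eqr_nat eqSS => /eqP.
- by rewrite size_map size_iota.
Qed.

(** On a square with [t] parts equal to [t] the power sum of exponent [k - 1] is [t^k], and [k] is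
    even. *)
Lemma Salg_square f : Salg f ->
  exists p : {poly rat}, forall t : nat, f (mkpart (nseq t t)) = p.[t%:R ^+ 2].
Proof.
elim=> {f} [|k ek k2|f g _ [p Hp] _ [q Hq]|c f _ [p Hp]|f g _ [p Hp] _ [q Hq]].
- by exists 1 => t; rewrite hornerC.
- exists ((- bern k / (2 * k)%:R)%:P + 'X^(k./2)) => t.
  rewrite /Smom hornerD hornerC hornerXn; congr (_ + _).
  rewrite -exprM mul2n even_halfK //.
  case: t => [|t]; first by rewrite /= big_nil expr0n; case: k k2 {ek}.
  rewrite (perm_big (nseq t.+1 t.+1)); last first.
    by rewrite mkpartE ?perm_sort //; apply/allP => x /nseqP[->].
  rewrite big_nseq iter_addr_0 -[LHS]mulr_natr natrX -exprSr prednK //.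
  exact: ltnW.
- by exists (p + q) => t; rewrite hornerD /padd Hp Hq.
- by exists (c *: p) => t; rewrite hornerZ /pscale Hp.
- by exists (p * q) => t; rewrite hornerM /ppmul Hp Hq.
Qed.

Lemma faulhaber2 r : faulhaber 2 r = r%:R * r.+1%:R / 2.
Proof.
elim: r => [|r IH]; first by rewrite faulhaber0 !mul0r.
by rewrite faulhaberS IH expn1; field.
Qed.

(** On the square the value is [t^2 * t(t+1)/2 = (t^4 + t^3)/2], which is not even in [t]: it is 1
    at 1 and 0 at -1. *)
Lemma tfun21_not_Salg : ~ Salg (tfun 2 1).
Proof.
move=> /Salg_square [p Hp].
have E : p \Po 'X^2 = 2^-1 *: ('X^4 + 'X^3).
  apply: poly_nat_eq => t; rewrite horner_comp hornerXn -Hp hornerZ hornerD !hornerXn.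
  have pos : all (fun x => (0 < x)%N) (nseq t.+1 t.+1) by apply/allP => x /nseqP[->].
  set l := mkpart _.
  have M i : mlt i l = ((t == i) * t.+1)%N.
    by rewrite /mlt /rmult mkpartE // (permP (permEl (perm_sort _ _))) count_nseq.
  have tN : (t < psize l)%N.
    by rewrite /psize mkpartE // (perm_sumn (permEl (perm_sort _ _))) sumn_nseq mulSn leq_addr.
  rewrite /tfun /msum (bigD1 (Ordinal tN)) //= big1 ?addr0 => [|i].
    by rewrite /fau M eqxx mul1n faulhaber2 natrX -[t.+2%:R]natr1; field.
  by rewrite -val_eqE /= eq_sym /fau M => /negbTE ->; rewrite mul0n faulhaber0 mulr0.
have E1 := congr1 (fun q : {poly rat} => q.[1]) E.
have := congr1 (fun q : {poly rat} => q.[-1]) E.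
move: E1; rewrite /= !horner_comp !hornerZ !hornerD !hornerXn !expr1n => -> /eqP.
by rewrite !exprS expr0.
Qed.

Lemma join_eq_psing i a b : (pjoin a b == psing i) =
  (a == psing i) && (b == pnil) || (a == pnil) && (b == psing i).
Proof.
apply/eqP/orP => [E|[] /andP[/eqP -> /eqP ->]]; rewrite ?pjoin0 // ?[pjoin _ pnil]pjoinC ?pjoin0 //.
have := congr1 (mlt i) E; rewrite mlt_join mlt_psing eqxx.
case: (psingP i a) => [m am _|_]; [left | case: (psingP i b) => [m bm _|//]; right].
  have [m0 b0] : m = pnil /\ b = pnil.
    have := E; rewrite am -pjoinA -[RHS]pjoin0 [pjoin pnil _]pjoinC => /join_psing_inj/(congr1 psize).
    by rewrite psize_join => /eqP; rewrite addn_eq0 !psize_eq0 => /andP[/eqP -> /eqP ->].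
  by rewrite am m0 pjoinC pjoin0 b0 !eqxx.
have [m0 a0] : m = pnil /\ a = pnil.
  have := E; rewrite bm pjoinC -pjoinA -[RHS]pjoin0 [pjoin pnil _]pjoinC => /join_psing_inj/(congr1 psize).
  by rewrite psize_join => /eqP; rewrite addn_eq0 !psize_eq0 => /andP[/eqP -> /eqP ->].
by rewrite bm m0 pjoinC pjoin0 a0 !eqxx.
Qed.

Lemma psing_neq0 i : (psing i == pnil) = false.
Proof. by rewrite -psize_eq0 psize_psing. Qed.

Lemma mul_psing i (f g : Pfun) :
  (f * g) (psing i) = f (psing i) * g pnil + f pnil * g (psing i).
Proof.
have D (x y : partition) (N := psize (psing i)) : (psize x <= N)%N -> (psize y <= N)%N ->
    \sum_(a <- ple N) \sum_(b <- ple N)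
      (if x == a then if y == b then f a * g b else 0 else 0) = f x * g y.
  move=> xN yN; rewrite -(sum_delta (fun a => f a * g y) (ple_uniq N)) ?mem_ple //.
  apply: eq_bigr => a _; case: eqP => _; last by rewrite big1.
  by rewrite (sum_delta (fun b => f a * g b)) ?ple_uniq ?mem_ple.
rewrite (mulE _ _ (leqnn _)) -(D (psing i) pnil) // -(D pnil (psing i)) // -big_split.
apply: eq_bigr => a _; rewrite -big_split; apply: eq_bigr => b _ /=.
rewrite join_eq_psing ![_ == a]eq_sym ![_ == b]eq_sym.
case: (eqVneq a (psing i)) => [->|_]; first by rewrite psing_neq0 /= orbF addr0.
by rewrite add0r /=; case: (a == pnil).
Qed.

(** A one-part partition has only the two trivial splittings, so [h * Z = f * g] expresses the value
    of [h] there through values of [f] and [g] at it and at the empty partition. For the generators,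
    [k - 1 > 0] makes the power vanish at 0. *)
Lemma SymS_single f : SymS f ->
  exists2 p : {poly rat}, p.[0] = f pnil & forall i, f (psing i) = p.[i.+1%:R].
Proof.
elim=> {f} [f|f g _ [p p0 Hp] _ [q q0 Hq]|c f _ [p p0 Hp]|f g h _ [p p0 Hp] _ [q q0 Hq]].
- elim=> {f} [|k ek k2|f g _ [p p0 Hp] _ [q q0 Hq]|c f _ [p p0 Hp]|f g _ [p p0 Hp] _ [q q0 Hq]].
  + by exists 1 => [|i]; rewrite hornerC.
  + exists ((- bern k / (2 * k)%:R)%:P + 'X ^+ k.-1) => [|i].
      by rewrite hornerD hornerC hornerXn expr0n /Smom /= big_nil; case: k k2 {ek} => [|[]].
    by rewrite hornerD hornerC hornerXn /Smom mkpartE // big_seq1 natrX.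
  + by exists (p + q) => [|i]; rewrite hornerD /padd ?p0 ?q0 ?Hp ?Hq.
  + by exists (c *: p) => [|i]; rewrite hornerZ /pscale ?p0 ?Hp.
  + by exists (p * q) => [|i]; rewrite hornerM /ppmul ?p0 ?q0 ?Hp ?Hq.
- by exists (p + q) => [|i]; rewrite hornerD /padd ?p0 ?q0 ?Hp ?Hq.
- by exists (c *: p) => [|i]; rewrite hornerZ /pscale ?p0 ?Hp.
move/odotE => E.
have E0 : h pnil = f pnil * g pnil.
  by have := congr1 (fun u : Pfun => u pnil) E; rewrite /= !mul_nil mulr1.
have E1 i : h (psing i) = f (psing i) * g pnil + f pnil * g (psing i) - f pnil * g pnil.
  have := congr1 (fun u : Pfun => u (psing i)) E; rewrite /= !mul_psing !mulr1 E0.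
  by move/(canRL (addrK _)).
exists (q.[0] *: p + p.[0] *: q - (p.[0] * q.[0])%:P) => [|i].
  by rewrite !hornerE E0 p0 q0; ring.
by rewrite E1 !hornerE Hp Hq p0 q0; ring.
Qed.

(** [T_{0,2}] is constant on one-part partitions, but larger by 1 there than at the empty
    partition. *)
Lemma Tmom02_not_SymS : ~ SymS (Tmom 0 2).
Proof.
move=> /SymS_single [p].
have E i : Tmom 0 2 (psing i) = Tcst 0 2 + 1.
  rewrite TmomE addpE scalepE mulr1; congr (_ + _).
  have iN : (i < psize (psing i))%N by rewrite psize_psing.
  rewrite /tfun /msum (bigD1 (Ordinal iN)) //= big1 ?addr0 => [|j].
    by rewrite /fau mlt_psing eqxx /faulhaber big_nat1 expn0 mulr1.
  rewrite -val_eqE /= => ji; rewrite /fau mlt_psing eq_sym (negbTE ji) faulhaber0 mulr0 //.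
have -> : Tmom 0 2 pnil = Tcst 0 2.
  by rewrite TmomE addpE scalepE mulr1 /tfun msum_vanish0 addr0.
move=> p0 Hp; have pE : p = (Tcst 0 2 + 1)%:P.
  by apply: poly_nat_eq => i; rewrite -Hp E hornerC.
by move: p0; rewrite pE hornerC => /eqP; rewrite -subr_eq0 addrAC subrr add0r.
Qed.

Lemma Salg_SymS_strict : strict_subset Salg SymS.
Proof.
split; first exact: SymS_S.
by exists (tfun 2 1); split; [exact: SymS_tfun | exact: tfun21_not_Salg].
Qed.

Lemma SymS_Talg_strict : strict_subset SymS Talg.
Proof.
split; first exact: SymS_Talg.
by exists (Tmom 0 2); split; [exact: TalgT | exact: Tmom02_not_SymS].
Qed.

(** * Formal q-series and Bernoulli numbers *)

(** Truncation transfers the ring laws from polynomials. *)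
Lemma smul_trunc N (a b : series) n : (n < N)%N ->
  smul a b n = (\poly_(i < N) a i * \poly_(i < N) b i)`_n.
Proof.
move=> nN; rewrite coefM; apply: eq_bigr => i _.
by rewrite !coef_poly (leq_ltn_trans (leq_subr _ _) nN) (leq_ltn_trans (leq_ord i) nN).
Qed.

Lemma smulC : commutative smul.
Proof. by move=> a b; apply: funext => n; rewrite !(@smul_trunc n.+1) // mulrC. Qed.

Lemma coef_mul_trunc N (p q : {poly rat}) n : (n < N)%N ->
  (\poly_(i < N) p`_i * q)`_n = (p * q)`_n.
Proof.
move=> nN; rewrite !coefM; apply: eq_bigr => i _.
by rewrite coef_poly (leq_ltn_trans (leq_ord i) nN).
Qed.

Lemma smulA : associative smul.
Proof.
move=> a b c; apply: funext => n.
have E x y : \poly_(i < n.+1) smul x y i =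
    \poly_(i < n.+1) (\poly_(j < n.+1) x j * \poly_(j < n.+1) y j)`_i.
  apply/polyP => i; rewrite !coef_poly; case: ifP => // ni.
  exact: smul_trunc.
rewrite (smulC a) !(@smul_trunc n.+1 (smul _ _)) // !E !coef_mul_trunc //.
by rewrite mulrC mulrA.
Qed.

Lemma smul1 : left_id sone smul.
Proof.
move=> a; apply: funext => n; rewrite /smul big_ord_recl /sone /= mul1r subn0.
by rewrite big1 ?addr0 // => i _; rewrite mul0r.
Qed.

Lemma smulDl : left_distributive smul sadd.
Proof.
move=> a b c; apply: funext => n; rewrite /smul /sadd -big_split.
by apply: eq_bigr => i _; rewrite mulrDl.
Qed.

Definition sopp (a : series) : series := fun n => - a n.

HB.instance Definition _ := gen_eqMixin series.
HB.instance Definition _ := gen_choiceMixin series.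

Lemma saddA : associative sadd.
Proof. by move=> f g h; apply: funext => l; rewrite /sadd addrA. Qed.
Lemma saddC : commutative sadd.
Proof. by move=> f g; apply: funext => l; rewrite /sadd addrC. Qed.
Lemma sadd0 : left_id szero sadd.
Proof. by move=> f; apply: funext => l; rewrite /sadd /szero add0r. Qed.
Lemma saddN : left_inverse szero sopp sadd.
Proof. by move=> f; apply: funext => l; rewrite /sadd /sopp addNr. Qed.
HB.instance Definition _ := GRing.isZmodule.Build series saddA saddC sadd0 saddN.
Lemma sone_neq0 : sone != 0 :> series.
Proof. by apply/eqP => /(congr1 (fun f : series => f 0%N)). Qed.
HB.instance Definition _ :=
  GRing.Zmodule_isComNzRing.Build series smulA smulC smul1 smulDl sone_neq0.
Lemma sscaleA a b f : sscale a (sscale b f) = sscale (a * b) f.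
Proof. by apply: funext => l; rewrite /sscale mulrA. Qed.
Lemma sscale1 : left_id 1 sscale.
Proof. by move=> f; apply: funext => l; rewrite /sscale mul1r. Qed.
Lemma sscaleDr : right_distributive sscale sadd.
Proof. by move=> a f g; apply: funext => l; rewrite /sscale /sadd mulrDr. Qed.
Lemma sscaleDl f : {morph sscale^~ f : a b / a + b >-> sadd a b}.
Proof. by move=> a b; apply: funext => l; rewrite /sscale /sadd mulrDl. Qed.
HB.instance Definition _ :=
  GRing.Zmodule_isLmodule.Build rat series sscaleA sscale1 sscaleDr sscaleDl.
Lemma sscaleAl c (f g : series) : sscale c (smul f g) = smul (sscale c f) g.
Proof.
apply: funext => n; rewrite /sscale /smul mulr_sumr.
by apply: eq_bigr => i _; rewrite mulrA.
Qed.
HB.instance Definition _ := GRing.Lmodule_isLalgebra.Build rat series sscaleAl.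
HB.instance Definition _ := GRing.Lalgebra_isComAlgebra.Build rat series.

Lemma addsE (f g : series) n : (f + g) n = f n + g n. Proof. by []. Qed.
Lemma subsE (f g : series) n : (f - g) n = f n - g n. Proof. by []. Qed.
Lemma scalesE c (f : series) n : (c *: f) n = c * f n. Proof. by []. Qed.
Lemma onesE n : (1 : series) n = (n == 0%N)%:R.
Proof. by rewrite -[LHS]/(sone n) /sone; case: eqP. Qed.
Lemma mulsE (f g : series) n : (f * g) n = \sum_(i < n.+1) f i * g (n - i)%N.
Proof. by []. Qed.
Lemma sum_serE (I : Type) (r : seq I) (P : pred I) (F : I -> series) n :
  (\sum_(i <- r | P i) F i) n = \sum_(i <- r | P i) F i n.
Proof. exact: (big_morph (fun f : series => f n)). Qed.

(** This is [q d/dq] on q-expansions and [x d/dx] on the exponential generating functions of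
    Bernoulli numbers. *)
Definition qD (a : series) : series := fun n => n%:R * a n.

Lemma qDD a b : qD (a + b) = qD a + qD b.
Proof. by apply: funext => n; exact: mulrDr. Qed.
Lemma qDZ c a : qD (c *: a) = c *: qD a.
Proof. by apply: funext => n; exact: mulrCA. Qed.
Lemma qDM a b : qD (a * b) = qD a * b + a * qD b.
Proof.
apply: funext => n; rewrite addsE /qD !mulsE mulr_sumr -big_split.
apply: eq_bigr => i _ /=; rewrite mulrCA -mulrA [in RHS]mulrCA -mulrDr.
rewrite [a i * (_ * _)]mulrCA -mulrDl -natrD subnKC ?leq_ord //; ring.
Qed.
Lemma qD1 : qD 1 = 0.
Proof. by apply: funext => -[|n]; rewrite /qD onesE ?mul0r ?mulr0. Qed.

Definition fct (n : nat) : rat := (n`!)%:R.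
Lemma fct_neq0 n : fct n != 0. Proof. by rewrite pnatr_eq0 -lt0n fact_gt0. Qed.
Lemma fct0 : fct 0 = 1. Proof. by []. Qed.
Lemma fct1 : fct 1 = 1. Proof. by []. Qed.
Lemma fctS n : fct n.+1 = n.+1%:R * fct n. Proof. by rewrite /fct factS natrM. Qed.

Ltac nonzero := rewrite ?fct_neq0 ?nat1r ?natr1 -?natrD ?pnatr_eq0 //.

Lemma binR n i : (i <= n)%N -> ('C(n, i))%:R = fct n / (fct i * fct (n - i)).
Proof.
move=> ni; apply: (canRL (mulfK _)); first by rewrite mulf_neq0 ?fct_neq0.
by rewrite /fct -!natrM bin_fact.
Qed.

Lemma bern0 : bern 0 = 1. Proof. by []. Qed.

Lemma size_bern_seq n : size (bern_seq n) = n.+1.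
Proof. by elim: n => //= n IH; rewrite size_rcons IH. Qed.

Lemma nth_bern_seq n j : (j <= n)%N -> nth 0 (bern_seq n) j = bern j.
Proof.
elim: n j => [|n IH] j; first by rewrite leqn0 => /eqP ->.
rewrite leq_eqVlt => /orP[/eqP -> //|jn].
by rewrite /= nth_rcons size_bern_seq jn IH.
Qed.

Lemma bernS m : bern m.+1 = - (m.+2)%:R^-1 * \sum_(j < m.+1) ('C(m.+2, j))%:R * bern j.
Proof.
rewrite {1}/bern /= nth_rcons size_bern_seq ltnn eqxx; congr (_ * _).
by apply: eq_bigr => j _; rewrite nth_bern_seq // -ltnS.
Qed.

Lemma bern_sum m : \sum_(j < m.+2) ('C(m.+2, j))%:R * bern j = 0.
Proof.
rewrite big_ord_recr /= bernS binSn mulrA mulrN mulfV ?pnatr_eq0 // mulN1r.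
exact: subrr.
Qed.

(* Exponential generating functions: [bser] is x/(e^x - 1), [eser] is (e^x - 1)/x. *)
Definition bser : series := fun n => bern n / fct n.
Definition eser : series := fun n => (fct n.+1)^-1.
Definition xser : series := fun n => (n == 1%N)%:R.

Lemma xserM (f : series) n : (xser * f) n = if n is m.+1 then f m else 0.
Proof.
rewrite mulsE; case: n => [|n]; first by rewrite big_ord1 /xser mul0r.
rewrite 2!big_ord_recl big1 => [|i _]; last by rewrite /xser mul0r.
by rewrite /xser /= mul0r add0r mul1r subSS subn0 addr0.
Qed.

Lemma bser_eser : bser * eser = 1.
Proof.
apply: funext => -[|n]; rewrite mulsE onesE.
  by rewrite big_ord1 /bser /eser bern0 fct0 fct1 !divr1.
have -> : \sum_(i < n.+2) bser i * eser (n.+1 - i)%N =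
   (fct n.+2)^-1 * \sum_(i < n.+2) ('C(n.+2, i))%:R * bern i; last by rewrite bern_sum mulr0.
rewrite mulr_sumr; apply: eq_bigr => i _.
rewrite binR ?(leq_trans (leq_ord i)) // /bser /eser -subSn ?leq_ord //.
by field; nonzero.
Qed.

Lemma qD_eser : qD eser = xser * eser + 1 - eser.
Proof.
apply: funext => n; rewrite subsE addsE xserM onesE /qD /eser.
case: n => [|n] /=; first by rewrite fct1; field.
by rewrite [fct n.+2]fctS addr0; field; nonzero.
Qed.

Lemma qD_bser : qD bser = bser - xser * bser - bser ^+ 2.
Proof.
have := congr1 qD bser_eser; rewrite qDM qD1 qD_eser => /(congr1 (fun u : series => bser * u)).
rewrite mulr0 => /eqP E; apply/eqP; rewrite -subr_eq0 -(eqP E).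
apply/eqP; have be := bser_eser.
transitivity (qD bser * (bser * eser) + bser * (xser * (bser * eser)) + bser ^+ 2 - bser * (bser * eser)); last by ring.
by rewrite be; ring.
Qed.

(* [gser] is x/(e^x - 1) + x/2, an even series. *)
Definition gser : series := bser + 2^-1 *: xser.

Lemma gser_bern n : (n != 1)%N -> gser n = bern n / fct n.
Proof. by move=> n1; rewrite /gser addsE scalesE /xser (negbTE n1) mulr0 addr0. Qed.

Lemma bern1 : bern 1 = - 2^-1.
Proof. by rewrite bernS big_ord1 /bern /= bin0 !mulr1. Qed.

Lemma gser0 : gser 0 = 1.
Proof. by rewrite gser_bern // bern0 fct0 divr1. Qed.

Lemma gser1 : gser 1 = 0.
Proof. by rewrite /gser addsE scalesE /bser bern1 /xser fct1 divr1 mulr1 addNr. Qed.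

(** Adding [x/2] completes the square in the Riccati equation of [bser] and removes the linear term
    [xser * bser]; the new equation is invariant under [x -> -x]. *)
Lemma qD_gser : qD gser = gser - gser ^+ 2 + 4^-1 *: xser ^+ 2.
Proof.
have qDx : qD xser = xser.
  by apply: funext => -[|[|n]]; rewrite /qD /xser ?mul0r ?mul1r // mulr0.
rewrite /gser qDD qDZ qDx qD_bser; set h : series := 2^-1%:A.
have h2 : h * 2 = 1 by rewrite mulr_algl -[2]/(2%:R) -scaler_nat scalerA mulVf ?scale1r.
have -> : 2^-1 *: xser = h * xser by rewrite mulr_algl.
have -> : 4^-1 *: xser ^+ 2 = h ^+ 2 * xser ^+ 2.
  have -> : h ^+ 2 = 4^-1%:A by rewrite /h expr2 mulr_algl scalerA -invfM -natrM.
  by rewrite mulr_algl.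
rewrite -[in LHS](mul1r (xser * bser)) -h2; ring.
Qed.

Lemma gser_rec n : (2 < n)%N ->
  \sum_(i < n.+1) gser i * gser (n - i)%N = (1 - n%:R) * gser n.
Proof.
move=> n2; have := congr1 (fun u : series => u n) qD_gser.
rewrite /= addsE subsE scalesE expr2 [X in _ + _ * X]xserM.
(* The term [x^2 / 4] is felt only at [n = 2]. *)
have -> : (if n is m.+1 then xser m else 0) = 0 by case: n n2 => [|[|[|n]]].
rewrite mulr0 addr0 -mulsE -expr2 /qD mulrBl mul1r => ->; ring.
Qed.

Lemma gser_inner n : (2 < n)%N ->
  \sum_(i < n.-1) gser i.+1 * gser (n - i.+1)%N = - (n.+1)%:R * gser n.
Proof.
case: n => [|[|n]] // n2; have := gser_rec n2.
rewrite big_ord_recl big_ord_recr /= subn0 gser0 /bump /= !add1n subnn gser0 mul1r mulr1.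
move=> /(canRL (addKr _)) /(canRL (addrK _)) ->.
rewrite -!natr1; ring.
Qed.

(** For odd [n] each product in [gser_inner] has a factor of smaller odd index, which vanishes by
    induction. *)
Lemma gser_odd n : odd n -> gser n = 0.
Proof.
elim/ltn_ind: n => n IH on.
case: (ltnP 2 n) => [n2|]; last by case: n on {IH} => [|[|[|n]]] // _ _; exact: gser1.
have := gser_inner n2; rewrite big1 => [/esym/eqP|i _].
  by rewrite mulf_eq0 oppr_eq0 pnatr_eq0 => /eqP.
have ni : (i.+1 < n)%N by have := ltn_ord i; lia.
case: (boolP (odd i.+1)) => [oi|oi]; first by rewrite IH ?mul0r.
by rewrite (IH (n - i.+1)%N) ?mulr0 ?oddB 1?ltnW // ?on ?(negbTE oi) //; lia.
Qed.

Definition psum (n d : nat) : rat := \sum_(b < d) b%:R ^+ n.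

(** The coefficient form of [\sum_(b < d) e^(bx) = (e^(dx) - 1) / (e^x - 1)]; the auxiliary [s] and
    [e] are the two sides before division by [eser]. *)
Lemma psum_bser n d :
  psum n d / fct n = \sum_(j < n.+1) bser j * (d%:R ^+ (n.+1 - j) / fct (n.+1 - j)).
Proof.
pose s d : series := fun n => psum n d / fct n.
pose e d : series := fun n => d%:R ^+ n.+1 / fct n.+1.
have H k : s k * eser = e k.
  elim: k => [|k IH]; apply: funext => m.
    rewrite mulsE big1 ?/e ?expr0n ?mul0r // => i _.
    by rewrite /s /psum big_ord0 !mul0r.
  have -> : s k.+1 = s k + (fun m => k%:R ^+ m / fct m : rat).
    by apply: funext => j; rewrite addsE /s /psum big_ord_recr /= mulrDl.
  rewrite mulrDl addsE IH /e -natr1 exprDn mulsE.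
  under [in RHS]eq_bigr => i _ do rewrite expr1n mulr1.
  rewrite [in RHS]big_ord_recl /= bin0 mulr1n subn0 mulrDl; congr (_ + _).
  rewrite mulr_suml [LHS](reindex_inj rev_ord_inj) /=; apply: eq_bigr => i _.
  have im := leq_ord i; rewrite /bump /= add1n !subSS subKn //.
  rewrite -[_ *+ 'C(_, _)]mulr_natr binR // subSS /eser.
  by field; nonzero.
have -> : psum n d / fct n = s d n by [].
have -> : s d = bser * e d by rewrite -H mulrCA bser_eser mulr1.
rewrite mulsE; apply: eq_bigr => j _.
by rewrite /e -subSn ?leq_ord.
Qed.

(* The constant term of the Eisenstein series [Eis k]. *)
Definition eisc (k : nat) : rat := - bern k / (2 * k)%:R.

Lemma eisc_gser i : odd i -> fct i * gser i.+1 = - 2 * eisc i.+1.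
Proof.
move=> oi; rewrite gser_bern ?eqSS; last by case: i oi.
rewrite /eisc fctS natrM; field; nonzero.
Qed.

Lemma faulhaber_formula n d : ~~ odd n -> (0 < n)%N ->
  psum n d = d%:R ^+ n.+1 / n.+1%:R - d%:R ^+ n / 2
    - 2 * \sum_(i < n.+1 | odd i) ('C(n, i))%:R * eisc i.+1 * d%:R ^+ (n - i).
Proof.
move=> en n0; apply: (mulIf (invr_neq0 (fct_neq0 n))); rewrite psum_bser.
rewrite big_ord_recl /= subn0 /bser bern0 fct0 divr1 mul1r fctS -addrA mulrDl; congr (_ + _).
  by field; nonzero.
(* [bser] and [gser] differ only in degree one, and this difference yields the term [- d^n / 2]. *)
have -> : \sum_(i < n) bern (bump 0 i) / fct (bump 0 i) *
    (d%:R ^+ (n.+1 - bump 0 i) / fct (n.+1 - bump 0 i)) =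
  \sum_(i < n) (gser i.+1 - (val i == 0%N)%:R / 2) * (d%:R ^+ (n - i) / fct (n - i)).
  apply: eq_bigr => i _; rewrite /bump /= add1n subSS; congr (_ * _).
  by rewrite /gser addsE scalesE /xser eqSS /= [2^-1 * _]mulrC addrK.
under [LHS]eq_bigr => i _ do rewrite mulrBl.
rewrite sumrB addrC mulrDl; congr (_ + _); last first.
  case: n n0 en => // n _ _; rewrite big_ord_recl /= big1 => [|i _]; last first.
    by rewrite !mul0r.
  by rewrite subn0; field; nonzero.
rewrite [in RHS]big_mkcond big_ord_recr /= (negbTE en) addr0 mulNr mulr_sumr mulr_suml -sumrN.
apply: eq_bigr => i _; case: ifP => oi; last by rewrite gser_odd ?mulr0 ?mul0r ?oppr0 //= oi.
move: (eisc _) (eisc_gser oi) => c G; rewrite binR 1?ltnW //.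
have -> : gser i.+1 = - 2 * c / fct i by rewrite -G mulrC mulKf ?fct_neq0.
by field; nonzero.
Qed.

(** Euler's quadratic relation for Bernoulli numbers, obtained from [gser_inner]; it is the constant
    term of [Eis_heat]. *)
Lemma eisc_euler n : ~~ odd n -> (0 < n)%N ->
  \sum_(i < n.+1 | odd i) ('C(n, i))%:R * eisc i.+1 * eisc (n - i).+1 =
    n.+3%:R / (2 * n.+1)%:R * eisc n.+2.
Proof.
move=> en n0; have /gser_inner : (2 < n.+2)%N by [].
rewrite /= => E.
apply: (mulfI (_ : 4 != 0 :> rat)) => //.
have := congr1 (fun x => fct n * x) E; rewrite /= mulr_sumr => {}E.
transitivity (fct n * (- n.+3%:R * gser n.+2)); last first.
  apply: (mulfI (_ : n.+1%:R != 0 :> rat)); first by rewrite pnatr_eq0.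
  have := @eisc_gser n.+1 en; rewrite fctS => G.
  transitivity (- n.+3%:R * (n.+1%:R * fct n * gser n.+2)); first by ring.
  by rewrite G natrM; field; nonzero.
rewrite -E mulr_sumr big_mkcond; apply: eq_bigr => i _.
have ni : odd (n - i) = odd i by rewrite oddB ?leq_ord // (negbTE en).
case: ifP => oi; last by rewrite gser_odd ?mul0r ?mulr0 //= oi.
rewrite subSS subSn ?leq_ord //.
have G1 := eisc_gser oi; have G2 := @eisc_gser (n - i); rewrite ni in G2.
move: (eisc _) (eisc _) G1 (G2 oi) => c c' {}G1 {}G2.
transitivity ('C(n, i)%:R * (- 2 * c) * (- 2 * c')); first by ring.
rewrite -G1 -G2 // binR ?leq_ord //; field; nonzero.
Qed.

(** * A divisor-sum identity *)

(* In the library, [divisors 0 = [:: 1]]. *)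
Definition dvs (n : nat) : seq nat := if n is 0 then [::] else divisors n.

Lemma mem_dvs d n : (d \in dvs n) = (0 < n)%N && (d %| n)%N.
Proof. by case: n => [|n] //; rewrite -dvdn_divisors. Qed.

Lemma dvs_uniq n : uniq (dvs n).
Proof. by case: n => [|n] //; exact: divisors_uniq. Qed.

Definition sg (k : nat) : series := fun n => \sum_(d <- dvs n) (d%:R : rat) ^+ k.

Lemma EisE k : Eis k = eisc k *: 1 + sg k.-1.
Proof.
apply: funext => n; rewrite addsE scalesE onesE /Eis /sg.
case: n => [|n] /=; first by rewrite big_nil addr0 mulr1.
by rewrite mulr0 add0r; apply: eq_bigr => d _; rewrite natrX.
Qed.

Lemma sum_bij (T U : eqType) (V : nmodType) (s : seq T) (t : seq U) (P : pred T) (Q : pred U)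
    (h : T -> U) (h' : U -> T) (F : T -> V) (G : U -> V) : uniq s -> uniq t ->
  (forall x, x \in s -> P x -> [/\ h x \in t, Q (h x), h' (h x) = x & F x = G (h x)]) ->
  (forall y, y \in t -> Q y -> [/\ h' y \in s, P (h' y) & h (h' y) = y]) ->
  \sum_(x <- s | P x) F x = \sum_(y <- t | Q y) G y.
Proof.
move=> us ut H H'.
transitivity (\sum_(x <- [seq x <- s | P x]) G (h x)).
  rewrite -big_filter big_seq [RHS]big_seq; apply: eq_bigr => x.
  by rewrite mem_filter => /andP[Px xs]; case: (H x xs Px).
rewrite -(big_map h xpredT G) -[RHS]big_filter; apply: perm_big; apply: uniq_perm.
- rewrite map_inj_in_uniq ?filter_uniq // => x y; rewrite !mem_filter => /andP[Px xs] /andP[Py ys] E.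
  by case: (H x xs Px) => _ _ <- _; case: (H y ys Py) => _ _ <- _; rewrite E.
- exact: filter_uniq.
move=> y; rewrite mem_filter; apply/mapP/andP => [[x + ->]|[Qy yt]].
  by rewrite mem_filter => /andP[Px xs]; case: (H x xs Px).
by have [h's Ph' <-] := H' y yt Qy; exists (h' y); rewrite ?mem_filter ?Ph'.
Qed.

(* [(a, b, (x, y))] with [a x + b y = N] and all entries positive. *)
Definition quads (N : nat) : seq (nat * nat * (nat * nat)) :=
  [seq (p.1, p.2, (i %/ p.1, (N - i) %/ p.2))%N | i <- iota 0 N.+1,
     p <- [seq (a, b) | a <- dvs i, b <- dvs (N - i)]].

Definition isquad N (q : nat * nat * (nat * nat)) : bool :=
  [&& 0 < q.1.1, 0 < q.1.2, 0 < q.2.1, 0 < q.2.2 & q.1.1 * q.2.1 + q.1.2 * q.2.2 == N]%N.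

Lemma mem_quads N q : (q \in quads N) = isquad N q.
Proof.
case: q => [[a b] [x y]]; apply/allpairsPdep/idP => [[i [[c d] [+ + [-> -> -> ->]]]]|].
  rewrite mem_iota add0n ltnS => /andP[_ iN].
  move=> /allpairsP[[c' d'] /= []]; rewrite !mem_dvs => /andP[i0 ci] /andP[j0 dj] [-> ->].
  have c0 : (0 < c')%N by exact: dvdn_gt0 i0 ci.
  have d0 : (0 < d')%N by exact: dvdn_gt0 j0 dj.
  rewrite /isquad /= c0 d0 !divn_gt0 // (dvdn_leq i0 ci) (dvdn_leq j0 dj) /=.
  by rewrite mulnC divnK // mulnC divnK // subnKC.
rewrite /isquad => /and5P[/= a0 b0 x0 y0 /eqP E].
exists (a * x)%N, (a, b); rewrite -[0%N :: _]/(iota 0 N.+1) mem_iota add0n ltnS -E leq_addr addKn /= !mulKn //; split=> //.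
by apply/allpairsP; exists (a, b); rewrite !mem_dvs !muln_gt0 a0 b0 x0 y0 !dvdn_mulr.
Qed.

Lemma quads_uniq N : uniq (quads N).
Proof.
apply: allpairs_uniq_dep; first exact: iota_uniq.
  by move=> i _; apply: allpairs_uniq; rewrite ?dvs_uniq // => -[? ?] [? ?].
move=> [i [a b]] [j [c d]] /allpairsPdep[i' [p [_ + [-> ->]]]] /allpairsPdep[j' [p' [_ + [-> ->]]]] /=.
move=> /allpairsP[[x y] /= [+ _ ->]] /allpairsP[[z t] /= [+ _ ->]] /= [E1 E2 E3 _].
rewrite !mem_dvs => /andP[_ d1] /andP[_ d2].
have -> : i' = j' by rewrite -(divnK d1) E3 E1 divnK.
by rewrite E1 E2.
Qed.

Lemma sgM j m N : (sg j * sg m) N = \sum_(q <- quads N) q.1.1%:R ^+ j * q.1.2%:R ^+ m.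
Proof.
rewrite /quads big_allpairs_dep mulsE -[iota 0 N.+1]/(index_iota 0 N.+1) big_mkord.
apply: eq_bigr => i _; rewrite big_allpairs /= /sg mulr_suml.
by apply: eq_bigr => a _; rewrite mulr_sumr.
Qed.

(* Summing over [ax + by = N], the map [(a, b, x, y) -> (a - b, b, x, x + y)] carries
   the part [a > b] onto the part [x < y]. *)
Lemma quads_shear N (f : nat -> nat -> rat) :
  (forall a b, f a (a + b)%N = f (a + b)%N b) ->
  \sum_(q <- quads N) (f q.1.1 q.1.2 - f (q.1.1 + q.1.2)%N q.1.2) =
  \sum_(q <- quads N | q.1.1 == q.1.2) f q.1.1 q.1.1
  - \sum_(q <- quads N | q.2.1 == q.2.2) f (q.1.1 + q.1.2)%N q.1.2.
Proof.
move=> Hf; rewrite sumrB.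
have split3 (F : nat * nat * (nat * nat) -> rat) (u v : nat * nat * (nat * nat) -> nat) :
    \sum_(q <- quads N) F q = \sum_(q <- quads N | u q == v q) F q +
     (\sum_(q <- quads N | (v q < u q)%N) F q + \sum_(q <- quads N | (u q < v q)%N) F q).
  rewrite (bigID (fun q => u q == v q)) /=; congr (_ + _).
  rewrite (bigID (fun q => (v q < u q)%N)) /=; congr (_ + _); apply: eq_bigl => q.
    by case: ltngtP.
  by case: ltngtP.
rewrite (split3 _ (fun q => q.1.1) (fun q => q.1.2)).
rewrite [X in _ - X](split3 _ (fun q => q.2.2) (fun q => q.2.1)).
have -> : \sum_(q <- quads N | (q.1.2 < q.1.1)%N) f q.1.1 q.1.2 =
          \sum_(q <- quads N | (q.2.1 < q.2.2)%N) f (q.1.1 + q.1.2)%N q.1.2.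
  apply: (@sum_bij _ _ _ _ _ _ _
     (fun q => ((q.1.1 - q.1.2)%N, q.1.2, (q.2.1, q.2.1 + q.2.2)%N))
     (fun q => ((q.1.1 + q.1.2)%N, q.1.2, (q.2.1, q.2.2 - q.2.1)%N))); rewrite ?quads_uniq //.
    move=> [[a b] [x y]]; rewrite !mem_quads /isquad /= => /and5P[a0 b0 x0 y0 /eqP E] ba.
    have [h1 h2 h3 h4] : [/\ 0 < a - b, x < x + y, 0 < x + y & (a - b) * x + b * (x + y) == N]%N.
      by split; rewrite -?E; nia.
    by rewrite h1 h2 h3 h4 b0 x0 addKn subnK // ltnW.
  move=> [[a b] [x y]]; rewrite !mem_quads /isquad /= => /and5P[a0 b0 x0 y0 /eqP E] xy.
  have [h1 h2 h3 h4] : [/\ 0 < a + b, b < a + b, 0 < y - x & (a + b) * x + b * (y - x) == N]%N.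
    by split; rewrite -?E; nia.
  by rewrite h1 h2 h3 h4 b0 x0 addnK subnKC // ltnW.
(* The part [a < b] goes to the part [x > y] by the opposite shear; here the hypothesis on [f]
   enters. *)
have -> : \sum_(q <- quads N | (q.1.1 < q.1.2)%N) f q.1.1 q.1.2 =
          \sum_(q <- quads N | (q.2.2 < q.2.1)%N) f (q.1.1 + q.1.2)%N q.1.2.
  apply: (@sum_bij _ _ _ _ _ _ _
     (fun q => (q.1.1, (q.1.2 - q.1.1)%N, ((q.2.1 + q.2.2)%N, q.2.2)))
     (fun q => (q.1.1, (q.1.1 + q.1.2)%N, ((q.2.1 - q.2.2)%N, q.2.2)))); rewrite ?quads_uniq //.
    move=> [[a b] [x y]]; rewrite !mem_quads /isquad /= => /and5P[a0 b0 x0 y0 /eqP E] ab.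
    have [h1 h2 h3 h4] : [/\ 0 < b - a, y < x + y, 0 < x + y & a * (x + y) + (b - a) * y == N]%N.
      by split; rewrite -?E; nia.
    by rewrite h1 h2 h3 h4 a0 y0 addnK -Hf subnKC // ltnW.
  move=> [[a b] [x y]]; rewrite !mem_quads /isquad /= => /and5P[a0 b0 x0 y0 /eqP E] yx.
  have [h1 h2 h3 h4] : [/\ 0 < a + b, a < a + b, 0 < x - y & a * (x - y) + (a + b) * y == N]%N.
    by split; rewrite -?E; nia.
  by rewrite h1 h2 h3 h4 a0 y0 addKn subnK // ltnW.
rewrite opprD addrACA subrr addr0; congr (_ - _).
  by apply: eq_bigr => q /eqP <-.
by apply: eq_bigl => q; rewrite eq_sym.
Qed.

(** With [a = b = d] the equation is [x + y = N / d], which has [N / d - 1] positive solutions. *)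
Lemma quads_diag1 N (F : nat -> rat) :
  \sum_(q <- quads N | q.1.1 == q.1.2) F q.1.1 =
  \sum_(d <- dvs N) ((N %/ d)%:R - 1) * F d.
Proof.
pose t : seq (nat * nat) := [seq (d, x) | d <- dvs N, x <- iota 1 (N %/ d).-1].
have ut : uniq t.
  apply: allpairs_uniq_dep; rewrite ?dvs_uniq //.
    by move=> ? _; exact: iota_uniq.
  by move=> [? ?] [? ?] _ _ /= [-> ->].
have mt d x : ((d, x) \in t) = [&& 0 < N, d %| N, 0 < x & x < N %/ d]%N.
  apply/allpairsPdep/idP => [[d' [x' [+ + [-> ->]]]]|].
    rewrite mem_dvs mem_iota => /andP[-> dN] /andP[x0 +]; rewrite dN x0 /=.
    by move: x0; case: (N %/ d')%N => [|q] /=; lia.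
  move=> /and4P[N0 dN x0 xN]; exists d, x; rewrite mem_dvs N0 dN mem_iota x0; split=> //=.
  by rewrite add1n prednK //; exact: leq_trans xN.
transitivity (\sum_(p <- t) F p.1).
  apply: (@sum_bij _ _ _ _ _ _ _ (fun q => (q.1.1, q.2.1))
    (fun p => (p.1, p.1, (p.2, N %/ p.1 - p.2)%N))); rewrite ?quads_uniq //.
    move=> [[a b] [x y]]; rewrite mem_quads /isquad /= => /and5P[a0 b0 x0 y0 /eqP E] /eqP ab.
    have NE : N = (a * (x + y))%N by rewrite -E -ab mulnDr.
    rewrite mt NE muln_gt0 a0 addn_gt0 x0 /= dvdn_mulr // mulKn // addKn ab; split=> //.
    by rewrite -[X in (X < _)%N]addn0 ltn_add2l.
  move=> [d x]; rewrite mt mem_quads /isquad /= => /and4P[N0 dN x0 xN] _; rewrite eqxx; split=> //.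
  rewrite (dvdn_gt0 N0 dN) x0 subn_gt0 xN /= -mulnDr subnKC ?(ltnW xN) //.
  by rewrite mulnC divnK.
rewrite /t big_allpairs_dep big_seq [RHS]big_seq; apply: eq_bigr => d.
rewrite mem_dvs => /andP[N0 dN] /=.
rewrite big_const_seq count_predT size_iota iter_addr_0 -[LHS]mulr_natl -subn1 natrB //.
by rewrite divn_gt0 ?(dvdn_gt0 N0 dN) // (dvdn_leq N0 dN).
Qed.

(** With [x = y] the sum [d = a + b] divides [N], and [b] runs from 1 to [d - 1]. *)
Lemma quads_diag2 N (F : nat -> nat -> rat) :
  \sum_(q <- quads N | q.2.1 == q.2.2) F (q.1.1 + q.1.2)%N q.1.2 =
  \sum_(d <- dvs N) \sum_(1 <= b < d) F d b.
Proof.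
pose t : seq (nat * nat) := [seq (d, b) | d <- dvs N, b <- index_iota 1 d].
have ut : uniq t.
  apply: allpairs_uniq_dep; rewrite ?dvs_uniq //.
    by move=> ? _; exact: iota_uniq.
  by move=> [? ?] [? ?] _ _ /= [-> ->].
have mt d x : ((d, x) \in t) = [&& 0 < N, d %| N, 0 < x & x < d]%N.
  apply/allpairsPdep/idP => [[d' [x' [+ + [-> ->]]]]|].
    by rewrite mem_dvs mem_index_iota => /andP[-> ->].
  by move=> /and4P[N0 dN x0 xN]; exists d, x; rewrite mem_dvs N0 dN mem_index_iota x0.
transitivity (\sum_(p <- t) F p.1 p.2); last by rewrite /t big_allpairs_dep.
apply: (@sum_bij _ _ _ _ _ _ _ (fun q => (q.1.1 + q.1.2, q.1.2)%N)
    (fun p => ((p.1 - p.2)%N, p.2, (N %/ p.1, N %/ p.1)%N))); rewrite ?quads_uniq //.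
  move=> [[a b] [x y]]; rewrite mem_quads /isquad /= => /and5P[a0 b0 x0 y0 /eqP E] /eqP xy.
  have NE : N = ((a + b) * x)%N by rewrite -E -xy mulnDl.
  rewrite mt NE muln_gt0 addn_gt0 a0 x0 /= dvdn_mulr // addnK mulKn ?addn_gt0 ?a0 // xy b0; split=> //.
  by rewrite -[X in (X < _)%N]add0n ltn_add2r.
move=> [d b]; rewrite mt mem_quads /isquad /= => /and4P[N0 dN b0 bd] _.
rewrite eqxx subn_gt0 bd b0 divn_gt0 ?(dvdn_gt0 N0 dN) // (dvdn_leq N0 dN) -mulnDl subnK ?(ltnW bd) //.
by rewrite mulnC divnK // eqxx.
Qed.

Lemma quads_sum N (f : nat -> nat -> rat) :
  (forall a b, f a (a + b)%N = f (a + b)%N b) ->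
  \sum_(q <- quads N) (f q.1.1 q.1.2 - f (q.1.1 + q.1.2)%N q.1.2) =
  \sum_(d <- dvs N) (((N %/ d)%:R - 1) * f d d - \sum_(1 <= b < d) f d b).
Proof.
move=> Hf; rewrite quads_shear // sumrB.
by rewrite (quads_diag1 N (fun d => f d d)) quads_diag2.
Qed.

(** * Quasimodular forms *)

Lemma psum_itv n d : (0 < n)%N -> \sum_(1 <= b < d) b%:R ^+ n = psum n d.
Proof.
case: d => [|d] n0; first by rewrite /psum big_geq ?big_ord0.
by rewrite /psum -(big_mkord xpredT (fun b => b%:R ^+ n)) [RHS]big_ltn // expr0n eqn0Ngt n0 add0r.
Qed.

Lemma psum_itv_rev n d : (0 < n)%N -> \sum_(1 <= b < d) (d%:R - b%:R) ^+ n = psum n d.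
Proof.
move=> n0; rewrite -psum_itv // [RHS]big_nat_rev.
apply: eq_big_nat => b /andP[b1 bd]; congr (_ ^+ _).
by rewrite -natrB 1?ltnW //; congr _%:R; lia.
Qed.

Lemma odd_binomial n (a b : rat) :
  (a - b) ^+ n - (a + b) ^+ n =
  - 2 * \sum_(i < n.+1 | odd i) ('C(n, i))%:R * (a ^+ (n - i) * b ^+ i).
Proof.
rewrite exprBn exprDn -sumrB mulr_sumr [RHS]big_mkcond; apply: eq_bigr => i _.
rewrite -signr_odd; case: (odd i); rewrite ?expr0 ?mul1r ?subrr // expr1.
by rewrite -[X in X - _]mulr_natl -[X in _ - X]mulr_natl; ring.
Qed.

(** [quads_sum] is applied to [s^n + t^n + (s - t)^n]. The left side becomes
    [(a - b)^n - (a + b)^n], which gives the odd binomial terms; the right side is evaluated by the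
    Faulhaber formula. *)
Lemma sg_conv n : ~~ odd n -> (0 < n)%N ->
  \sum_(i < n.+1 | odd i) ('C(n, i))%:R *: (sg (n - i) * sg i) =
  (n.+3%:R / (2 * n.+1)%:R) *: sg n.+1 - qD (sg n.-1)
   - 2 *: \sum_(i < n.+1 | odd i) (('C(n, i))%:R * eisc i.+1) *: sg (n - i).
Proof.
move=> en n0; apply: funext => N.
pose f (a b : nat) : rat := a%:R ^+ n + b%:R ^+ n + (a%:R - b%:R) ^+ n.
have evn (x : rat) : (- x) ^+ n = x ^+ n by rewrite exprNn -signr_odd (negbTE en) mul1r.
have Hf a b : f a (a + b)%N = f (a + b)%N b.
  rewrite /f !natrD addrK opprD addrA subrr add0r evn; ring.
have := quads_sum N Hf.
have -> : \sum_(q <- quads N) (f q.1.1 q.1.2 - f (q.1.1 + q.1.2)%N q.1.2) =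
   - 2 * (\sum_(i < n.+1 | odd i) ('C(n, i))%:R *: (sg (n - i) * sg i)) N.
  rewrite sum_serE.
  under [in RHS]eq_bigr => i _ do rewrite scalesE sgM mulr_sumr.
  rewrite exchange_big /= mulr_sumr; apply: eq_bigr => q _.
  by rewrite -odd_binomial /f !natrD addrK; ring.
have -> : \sum_(d <- dvs N) (((N %/ d)%:R - 1) * f d d - \sum_(1 <= b < d) f d b) =
  - 2 * ((n.+3%:R / (2 * n.+1)%:R) *: sg n.+1 - qD (sg n.-1)
   - 2 *: \sum_(i < n.+1 | odd i) (('C(n, i))%:R * eisc i.+1) *: sg (n - i)) N.
  rewrite !subsE !scalesE sum_serE /qD /sg.
  under [X in 2 * X]eq_bigr => i _ do rewrite scalesE mulr_sumr.
  rewrite exchange_big /= !mulr_sumr -!sumrB mulr_sumr big_seq [RHS]big_seq.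
  apply: eq_bigr => d; rewrite mem_dvs => /andP[N0 dN].
  have d0 : (0 < d)%N by exact: dvdn_gt0 N0 dN.
  rewrite /f !big_split /= psum_itv // psum_itv_rev // subrr expr0n eqn0Ngt n0 addr0.
  have -> : \sum_(1 <= b < d) d%:R ^+ n = (d%:R - 1) * d%:R ^+ n :> rat.
    by rewrite sumr_const_nat -[LHS]mulr_natl natrB.
  rewrite faulhaber_formula //.
  (* Through [(N / d) d^n = N d^(n-1)] the factor [N / d] produces the derivative of [sg n.-1]. *)
  have -> : N%:R = (N %/ d)%:R * d%:R :> rat by rewrite -natrM divnK.
  set S := \sum_(i < _ | _) _.
  have -> : d%:R ^+ n.+1 = d%:R * (d%:R * d%:R ^+ n.-1) :> rat by rewrite -!exprS prednK.
  have -> : d%:R ^+ n = d%:R * d%:R ^+ n.-1 :> rat by rewrite -exprS prednK.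
  rewrite natrM.
  by field; nonzero.
by move/(mulfI (_ : - 2 != 0 :> rat)); apply.
Qed.

Lemma qD_cst c : qD (c *: 1) = 0. Proof. by rewrite qDZ qD1 scaler0. Qed.

(* The coefficient form of the heat equation satisfied by the theta function. *)
Lemma Eis_heat n : ~~ odd n -> (0 < n)%N ->
  \sum_(i < n.+1 | odd i) ('C(n, i))%:R *: (Eis (n - i).+1 * Eis i.+1) =
  (n.+3%:R / (2 * n.+1)%:R) *: Eis n.+2 - qD (Eis n).
Proof.
move=> en n0.
(* The two families of cross terms agree under [i -> n - i]; together they cancel the last sum in
   [sg_conv]. *)
have sym : \sum_(i < n.+1 | odd i) (('C(n, i))%:R * eisc (n - i).+1) *: sg i =
    \sum_(i < n.+1 | odd i) (('C(n, i))%:R * eisc i.+1) *: sg (n - i).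
  rewrite [LHS](reindex_inj rev_ord_inj) /=; apply: eq_big => [i|i _].
    by rewrite subSS oddB ?leq_ord // (negbTE en).
  by rewrite subSS subKn ?leq_ord // bin_sub ?leq_ord.
transitivity (\sum_(i < n.+1 | odd i) (
    (('C(n, i))%:R * eisc i.+1 * eisc (n - i).+1) *: (1 : series)
    + (('C(n, i))%:R * eisc (n - i).+1) *: sg i
    + (('C(n, i))%:R * eisc i.+1) *: sg (n - i)
    + ('C(n, i))%:R *: (sg (n - i) * sg i))).
  apply: eq_bigr => i _; rewrite !EisE /=; move: (eisc _) (eisc _) => c c'.
  rewrite mulrDl !mulrDr -!scalerAl -!scalerAr !mul1r !mulr1 !scalerDr !scalerA.
  by rewrite -!addrA [_ * c * c']mulrAC.
rewrite !big_split /= sym sg_conv // -scaler_suml eisc_euler //.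
rewrite !EisE /= qDD qD_cst add0r scalerDr scalerA -!addrA; congr (_ + _).
set S := \sum_(i < _ | _) _.
rewrite [(2 : rat)](_ : _ = 1 + 1) // scalerDl scale1r opprD.
by move: (_ *: sg n.+1) (qD _) => x y; ring.
Qed.

(** The square is expanded in [b]; the three fractions are the sums of the squares, cubes and fourth
    powers below [m]. *)
Lemma psum_sq (d : rat) m : \sum_(b < m) (d * b%:R * (d - b%:R)) ^+ 2 =
  d ^+ 2 * (d ^+ 2 * (m%:R * (m%:R - 1) * (2 * m%:R - 1) / 6) - 2 * d * (m%:R * (m%:R - 1) / 2) ^+ 2
    + m%:R * (m%:R - 1) * (2 * m%:R - 1) * (3 * m%:R ^+ 2 - 3 * m%:R - 1) / 30) :> rat.
Proof.
elim: m => [|m IH]; first by rewrite big_ord0; field.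
by rewrite big_ord_recr /= IH -natr1; field.
Qed.

(** For [f s t = (s t (s - t))^2] the diagonal term vanishes and
    [f a b - f (a + b) b = - 4 a^3 b^3]. *)
Lemma sg3_sq : sg 3 * sg 3 = 120^-1 *: (sg 7 - sg 3).
Proof.
apply: funext => N; rewrite sgM.
pose f (a b : nat) : rat := (a%:R * b%:R * (a%:R - b%:R)) ^+ 2.
have Hf a b : f a (a + b)%N = f (a + b)%N b by rewrite /f !natrD; ring.
have := quads_sum N Hf.
have -> : \sum_(q <- quads N) (f q.1.1 q.1.2 - f (q.1.1 + q.1.2)%N q.1.2) =
    - 4 * \sum_(q <- quads N) q.1.1%:R ^+ 3 * q.1.2%:R ^+ 3.
  by rewrite mulr_sumr; apply: eq_bigr => q _; rewrite /f !natrD; ring.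
have -> : \sum_(d <- dvs N) (((N %/ d)%:R - 1) * f d d - \sum_(1 <= b < d) f d b) =
  - 4 * (120^-1 *: (sg 7 - sg 3)) N.
  rewrite scalesE subsE -sumrB [120^-1 * _]mulr_sumr mulr_sumr; apply: eq_bigr => d _.
  rewrite /f subrr mulr0 expr0n mulr0 sub0r.
  have -> : \sum_(1 <= b < d) (d%:R * b%:R * (d%:R - b%:R)) ^+ 2 =
      \sum_(b < d) (d%:R * b%:R * (d%:R - b%:R)) ^+ 2 :> rat.
    rewrite -(big_mkord xpredT (fun b => (d%:R * b%:R * (d%:R - b%:R)) ^+ 2)).
    case: d => [|d]; first by rewrite !big_geq.
    by rewrite [RHS]big_ltn // mulr0 mul0r expr0n add0r.
  by rewrite psum_sq; field.
by move/(mulfI (_ : - 4 != 0 :> rat)); apply.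
Qed.

Lemma eisc2 : eisc 2 = - 24^-1.
Proof. by rewrite /eisc bernS big_ord_recr big_ord1 /= bern1 bern0 bin0 bin1; field. Qed.

Lemma eisc4 : eisc 4 = 240^-1.
Proof.
have := @eisc_euler 2 isT isT; rewrite big_mkcond !big_ord_recl big_ord0 /= bin1 eisc2.
rewrite !add0r !addr0 => E.
by apply: (@mulfI _ (5 / (2 * 3)%:R)); [|rewrite -E natrM; field].
Qed.

Lemma eisc6 : eisc 6 = - 504^-1.
Proof.
have E : 4 * eisc 2 * eisc 4 + 4 * eisc 4 * eisc 2 = 7 / (2 * 5)%:R * eisc 6.
  have := @eisc_euler 4 isT isT; rewrite big_mkcond !big_ord_recl big_ord0 /=.
  by rewrite !add0r !addr0.
by apply: (@mulfI _ (7 / (2 * 5)%:R)); [|rewrite -E eisc2 eisc4 natrM; field].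
Qed.

Lemma eisc8 : eisc 8 = 480^-1.
Proof.
have E : 6 * eisc 2 * eisc 6 + (20 * eisc 4 * eisc 4 + 6 * eisc 6 * eisc 2) =
    9 / (2 * 7)%:R * eisc 8.
  have := @eisc_euler 6 isT isT; rewrite big_mkcond !big_ord_recl big_ord0 /=.
  by rewrite !add0r !addr0.
by apply: (@mulfI _ (9 / (2 * 7)%:R)); [|rewrite -E eisc2 eisc4 eisc6 natrM; field].
Qed.

Lemma scale_sq_cancel (s t : series) (a b c d : rat) :
  s * s = c *: (t - s) -> d * (a * a) = b -> d * (a + a) = 1 -> d * c = 1 ->
  b *: 1 + t = d *: ((a *: 1 + s) * (a *: 1 + s)).
Proof.
move=> E <- h2 h3.
rewrite mulrDl !mulrDr -!scalerAl -!scalerAr !mul1r mulr1 E scalerA.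
apply: funext => N; rewrite !(subsE, addsE, scalesE).
transitivity (d * (a * a) * (1 : series) N + (d * (a + a)) * s N
  + (d * c) * (t N - s N)); last by ring.
by rewrite h2 h3 !mul1r -addrA [s N + _]addrC subrK.
Qed.

Lemma Eis8 : Eis 8 = 120 *: (Eis 4 * Eis 4).
Proof.
rewrite !EisE /= eisc8 eisc4.
by apply: (scale_sq_cancel sg3_sq); field.
Qed.

Lemma qmf_eq k k' a : qmf k a -> k = k' -> qmf k' a.
Proof. by move=> + <-. Qed.

Lemma qmfM k j a b : qmf k a -> qmf j b -> qmf (k + j) (a * b).
Proof.
move=> Ha Hb; elim: Ha => {k a} [k||k a a' _ IH _ IH'|k c a _ IH|k a _ IH|k a _ IH|k a _ IH].
- by rewrite -[szero]/(0 : series) mul0r; exact: qmf0.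
- by rewrite -[sone]/(1 : series) mul1r.
- by rewrite -[sadd a a']/(a + a') mulrDl; exact: qmfD.
- by rewrite -[sscale c a]/(c *: a) -scalerAl; exact: qmfZ.
- by rewrite -[smul _ a]/(Eis 2 * a) -mulrA addnAC; exact: qmfM2.
- by rewrite -[smul _ a]/(Eis 4 * a) -mulrA addnAC; exact: qmfM4.
- by rewrite -[smul _ a]/(Eis 6 * a) -mulrA addnAC; exact: qmfM6.
Qed.

Lemma qmfB k a b : qmf k a -> qmf k b -> qmf k (a - b).
Proof. by move=> Ha Hb; rewrite -scaleN1r; apply: qmfD => //; apply: qmfZ. Qed.

Lemma qmf_sum k (I : Type) (r : seq I) (P : pred I) (F : I -> series) :
  (forall i, P i -> qmf k (F i)) -> qmf k (\sum_(i <- r | P i) F i).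
Proof. by move=> H; apply: big_ind => //; [exact: qmf0 | move=> a b; exact: qmfD]. Qed.

Lemma qmf_scaleI k c (a : series) : c != 0 -> qmf k (c *: a) -> qmf k a.
Proof. by move=> c0 H; rewrite -[a]scale1r -(mulVf c0) -scalerA; exact: qmfZ. Qed.

Lemma qmf_Eis2 : qmf 2 (Eis 2).
Proof. by have := qmfM2 qmf1; rewrite -[smul _ _]/(Eis 2 * 1) mulr1. Qed.
Lemma qmf_Eis4 : qmf 4 (Eis 4).
Proof. by have := qmfM4 qmf1; rewrite -[smul _ _]/(Eis 4 * 1) mulr1. Qed.
Lemma qmf_Eis6 : qmf 6 (Eis 6).
Proof. by have := qmfM6 qmf1; rewrite -[smul _ _]/(Eis 6 * 1) mulr1. Qed.

Lemma qmf_heat_sum n : ~~ odd n ->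
  (forall i, odd i -> (i < n)%N -> qmf i.+1 (Eis i.+1)) ->
  qmf n.+2 (\sum_(i < n.+1 | odd i) ('C(n, i))%:R *: (Eis (n - i).+1 * Eis i.+1)).
Proof.
move=> en H; apply: qmf_sum => i oi; apply: qmfZ.
have i_n : (i < n)%N.
  have := leq_ord i; rewrite leq_eqVlt => /orP[/eqP E|//].
  by rewrite E (negbTE en) in oi.
have i0 : (0 < i)%N by case: (val i) oi.
apply: (@qmf_eq ((n - i).+1 + i.+1)); last by lia.
apply: qmfM; apply: H => //; last by lia.
by rewrite oddB ?oi ?(negbTE en) // ltnW.
Qed.

Lemma qmf_qD_Eis n : ~~ odd n -> (0 < n)%N ->
  (forall i, odd i -> (i < n)%N -> qmf i.+1 (Eis i.+1)) -> qmf n.+2 (Eis n.+2) ->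
  qmf n.+2 (qD (Eis n)).
Proof.
move=> en n0 H H2.
have -> : qD (Eis n) = (n.+3%:R / (2 * n.+1)%:R) *: Eis n.+2
  - \sum_(i < n.+1 | odd i) ('C(n, i))%:R *: (Eis (n - i).+1 * Eis i.+1).
  by rewrite Eis_heat // opprB addrC subrK.
by apply: qmfB; [apply: qmfZ | apply: qmf_heat_sum].
Qed.

(** By the product rule only the three generators matter. Solving the heat identity for their
    derivatives requires [G_4], [G_6] and [G_8], and [G_8] is supplied by [Eis8]. *)
Lemma qmf_qD k a : qmf k a -> qmf k.+2 (qD a).
Proof.
have D2 : qmf 4 (qD (Eis 2)).
  apply: qmf_qD_Eis qmf_Eis4 => // -[|[|i]] //= _ _; exact: qmf_Eis2.
have D4 : qmf 6 (qD (Eis 4)).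
  apply: qmf_qD_Eis qmf_Eis6 => // -[|[|[|[|i]]]] //= _ _; [exact: qmf_Eis2 | exact: qmf_Eis4].
have D6 : qmf 8 (qD (Eis 6)).
  apply: qmf_qD_Eis; rewrite ?Eis8 //; last by apply: qmfZ; apply: qmfM qmf_Eis4 qmf_Eis4.
  by move=> -[|[|[|[|[|[|i]]]]]] //= _ _; [exact: qmf_Eis2 | exact: qmf_Eis4 | exact: qmf_Eis6].
have step j e (b c : series) : qmf j b -> qmf j.+2 (qD b) -> qmf e c -> qmf e.+2 (qD c) ->
    qmf (j + e).+2 (qD (c * b)).
  move=> Hb Hb' Hc Hc'; rewrite qDM; apply: qmfD.
    by apply: (@qmf_eq (e.+2 + j)); [apply: qmfM | lia].
  by apply: (@qmf_eq (e + j.+2)); [apply: qmfM | lia].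
elim=> {k a} [k||k a b _ IH _ IH'|k c a _ IH|k a Ha IH|k a Ha IH|k a Ha IH].
- rewrite (_ : qD szero = szero); first exact: qmf0.
  by apply: funext => n; rewrite /qD mulr0.
- by rewrite [qD sone]qD1; exact: qmf0.
- by rewrite [qD _]qDD; exact: qmfD.
- by rewrite [qD _]qDZ; exact: qmfZ.
- exact: (step _ _ _ _ Ha IH qmf_Eis2 D2).
- exact: (step _ _ _ _ Ha IH qmf_Eis4 D4).
- exact: (step _ _ _ _ Ha IH qmf_Eis6 D6).
Qed.

(** The heat identity is now solved for the Eisenstein series of highest weight; the derivative in
    it is already covered by [qmf_qD]. *)
Lemma qmf_Eis k : ~~ odd k -> (2 <= k)%N -> qmf k (Eis k).
Proof.
elim/ltn_ind: k => -[|[|n]] // IH; rewrite /= negbK => en _.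
case: (posnP n) => [->|n0]; first exact: qmf_Eis2.
have Hi i : odd i -> (i < n)%N -> qmf i.+1 (Eis i.+1).
  by move=> oi i_n; apply: IH; rewrite /= ?negbK //; [lia | case: i oi {i_n}].
have Hn : qmf n.+2 (qD (Eis n)).
  by apply: qmf_qD; apply: IH => //; case: n en n0 {Hi} => [|[]].
apply: (@qmf_scaleI _ (n.+3%:R / (2 * n.+1)%:R)).
  by rewrite mulf_neq0 ?invr_neq0 ?pnatr_eq0 // muln_eq0.
rewrite -[_ *: _](subrK (qD (Eis n))) -Eis_heat //.
by apply: qmfD => //; exact: qmf_heat_sum.
Qed.

Lemma qmf_iter_qD n k a : qmf k a -> qmf (k + n.*2) (iter n qD a).
Proof.
by move=> Ha; elim: n => [|n IH]; rewrite ?addn0 //= doubleS !addnS; exact: qmf_qD.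
Qed.

Lemma iter_qDE n a N : iter n qD a N = N%:R ^+ n * a N.
Proof.
by elim: n => [|n IH] /=; rewrite ?mul1r // {1}/qD IH mulrA -exprS.
Qed.

(* The q-expansion of the bracket of a double moment function, without its constant
   term. *)
Definition tser (a b : nat) : series :=
  fun N => \sum_(d <- dvs N) (d%:R : rat) ^+ a * (N %/ d)%:R ^+ b.

Lemma tserC a b : tser a b = tser b a.
Proof.
apply: funext => N; rewrite /tser.
apply: (@sum_bij _ _ _ _ _ _ _ (fun d => (N %/ d)%N) (fun d => (N %/ d)%N)); rewrite ?dvs_uniq //.
  move=> d; rewrite !mem_dvs => /andP[N0 dN] _.
  by rewrite N0 dvdn_div // divnA // mulKn // mulrC.
move=> d; rewrite !mem_dvs => /andP[N0 dN] _.
by rewrite N0 dvdn_div // divnA // mulKn.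
Qed.

(** Termwise [d^a (N/d)^b = N^b d^(a-b)]. *)
Lemma tser_ge a b : (b <= a)%N -> tser a b = iter b qD (sg (a - b)).
Proof.
move=> ba; apply: funext => N; rewrite iter_qDE /sg mulr_sumr /tser.
rewrite big_seq [RHS]big_seq; apply: eq_bigr => d; rewrite mem_dvs => /andP[_ dN].
rewrite -[in N%:R](divnK dN) natrM exprMn -mulrA -exprD subnKC // mulrC //.
Qed.

Lemma qmf_tser_pos a b : (0 < a)%N -> (0 < b)%N -> odd (a + b) -> qmf (a + b).+1 (tser a b).
Proof.
wlog ba : a b / (b <= a)%N => [H|] a0 b0 ab.
  case: (leqP b a) => ba; first exact: H.
  by rewrite tserC addnC; apply: H; rewrite // 1?addnC // ltnW.
have oab : odd (a - b) by rewrite oddB // -oddD.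
(* As [b > 0], at least one derivative is taken, and it kills the constant term of the Eisenstein
   series. *)
have -> : tser a b = iter b qD (Eis (a - b).+1).
  rewrite tser_ge // EisE /=; case: b b0 ba ab oab => // b _ _ _ _.
  by rewrite !iterSr qDD qD_cst add0r.
apply: (@qmf_eq ((a - b).+1 + b.*2)); last by rewrite -addnn; lia.
by apply: qmf_iter_qD; apply: qmf_Eis; rewrite /= ?negbK //; case: (a - b)%N oab.
Qed.

(** * q-brackets *)

(** Sizes add under [pjoin], so the substitution [u_m = q^m] is multiplicative. *)
Lemma genserM (f g : Pfun) : genser (f * g) = genser f * genser g.
Proof.
apply: funext => n; rewrite mulsE /genser.
transitivity (\sum_(l <- parts n) \sum_(i < n.+1) \sum_(a <- parts i) \sum_(b <- parts (n - i))
    (if pjoin a b == l then f a * g b else 0)).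
  apply: eq_big_seq => l; rewrite mem_parts => /eqP <-.
  rewrite -[LHS]/(conv f g l) /conv; apply: eq_bigr => i _.
  by do 2!apply: eq_bigr => ? _; rewrite pjoinP.
rewrite exchange_big /=; apply: eq_bigr => i _.
rewrite mulr_suml exchange_big /=; apply: eq_big_seq => a; rewrite mem_parts => /eqP ai.
rewrite mulr_sumr exchange_big /=; apply: eq_big_seq => b; rewrite mem_parts => /eqP bi.
rewrite (sum_delta (fun=> f a * g b)) ?parts_uniq // mem_parts psize_join ai bi subnKC //.
by rewrite leq_ord.
Qed.

Lemma genserD (f g : Pfun) : genser (f + g) = genser f + genser g.
Proof.
apply: funext => n; rewrite addsE /genser -big_split.
by apply: eq_bigr => l _; rewrite addpE.
Qed.

Lemma genserZ c (f : Pfun) : genser (c *: f) = c *: genser f.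
Proof.
apply: funext => n; rewrite scalesE /genser mulr_sumr.
by apply: eq_bigr => l _; rewrite scalepE.
Qed.

Lemma genser1 : genser 1 = 1.
Proof.
apply: funext => n; rewrite onesE /genser; case: (n =P 0%N) => [->|/eqP n0].
  rewrite (eq_bigr (fun l => if pnil == l then 1 else 0)) => [|l _].
    by rewrite (sum_delta (fun=> 1)) ?parts_uniq ?mem_parts.
  by rewrite onepE eq_sym.
rewrite big1_seq // => l /= ln; rewrite onepE; case: eqP => // l0.
by move: ln n0; rewrite l0 mem_parts psize0 => /eqP <-.
Qed.

Lemma umono_size i l : umono i l -> psize l = (mlt i l * i.+1)%N.
Proof.
move=> /andP[_ /all_pred1P E]; rewrite /psize /mlt /rmult E sumn_nseq count_nseq /= eqxx mul1n.
by rewrite mulnC.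
Qed.

Lemma umono_eq i l : umono i l -> l = mkpart (nseq (mlt i l) i.+1).
Proof.
move=> /andP[_ /all_pred1P E]; apply: part_inj; rewrite mkpartE.
  by rewrite perm_sym perm_sort /mlt /rmult [X in perm_eq _ X]E {1}E count_nseq /= eqxx mul1n.
by apply/allP => x /nseqP[->].
Qed.

Lemma mlt_rect i r : mlt i (mkpart (nseq r i.+1)) = r.
Proof.
rewrite /mlt /rmult mkpartE; last by apply/allP => x /nseqP[->].
by rewrite (permP (permEl (perm_sort _ _))) count_nseq /= eqxx mul1n.
Qed.

Lemma umono_rect i r : (0 < r)%N -> umono i (mkpart (nseq r i.+1)).
Proof.
move=> r0; rewrite /umono mlt_rect r0 mkpartE; last by apply/allP => x /nseqP[->].
by rewrite all_sort; apply/allP => x /nseqP[->] /=.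
Qed.

(** At most one partition of [N] has all parts equal to [i+1]: the one with [N / (i+1)] parts. *)
Lemma sum_umono N i n : (i < N)%N ->
  \sum_(l <- parts N) ev i (ph n) l = if (i.+1 %| N)%N then (N %/ i.+1)%:R ^+ n else 0.
Proof.
move=> iN; case: ifP => iD; last first.
  rewrite big1_seq // => l; rewrite mem_parts ev_phE => /eqP lN.
  by case: ifP => // /umono_size E; move: iD; rewrite -lN E dvdn_mull.
have q0 : (0 < N %/ i.+1)%N by rewrite divn_gt0.
set l0 := mkpart (nseq (N %/ i.+1) i.+1).
have u0 : umono i l0 by exact: umono_rect.
have s0 : psize l0 = N by rewrite (umono_size u0) mlt_rect divnK.
rewrite (@sum_supp _ _ _ [:: l0]) ?parts_uniq // ?big_seq1.
  by rewrite ev_phE u0 mlt_rect.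
move=> l; rewrite ev_phE mem_parts inE; case: ifP => [u _|]; last by rewrite eqxx.
apply/eqP/eqP => [lN|->] //.
by rewrite (umono_eq u) /l0 -lN (umono_size u) mulnK.
Qed.

Lemma genser_pp k n : genser (pp k n) = tser k n.
Proof.
apply: funext => N; rewrite /genser.
transitivity (\sum_(i < N) (i.+1%:R ^+ k : rat) *
    (if (i.+1 %| N)%N then (N %/ i.+1)%:R ^+ n else 0)).
  transitivity (\sum_(l <- parts N) \sum_(i < N) (i.+1 ^ k)%:R * ev i (ph n) l).
    by apply: eq_big_seq => l; rewrite mem_parts => /eqP <-.
  rewrite exchange_big /=; apply: eq_bigr => i _.
  by rewrite -mulr_sumr sum_umono // natrX.
pose F (d : nat) : rat := d%:R ^+ k * (if (d %| N)%N then (N %/ d)%:R ^+ n else 0).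
rewrite -[LHS]/(\sum_(i < N) F i.+1).
have -> : \sum_(i < N) F i.+1 = \sum_(1 <= d < N.+1) F d by rewrite big_add1 big_mkord.
rewrite /tser (@sum_supp _ _ (index_iota 1 N.+1) (dvs N) F) ?iota_uniq ?dvs_uniq //.
  by apply: eq_big_seq => d; rewrite mem_dvs /F => /andP[_ ->].
move=> d; rewrite /F mem_index_iota mem_dvs; case: ifP => [dN _|]; last by rewrite mulr0 eqxx.
rewrite ltnS; case: (posnP N) => [-> |N0]; first by rewrite leqn0 andbC; case: d {dN}.
by rewrite (dvdn_gt0 N0 dN) (dvdn_leq N0 dN).
Qed.

(* The u-bracket of [Tmom k n.+1]. *)
Definition That (k n : nat) : Pfun := Tcst k n.+1 *: 1 + pp k n.

Lemma Tmom_That k n : Tmom k n.+1 = That k n * Z.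
Proof. by rewrite TmomE /That mulrDl -scalerAl mul1r tfunE. Qed.

Lemma Tcst0 k n : (0 < k)%N -> Tcst k n.+2 = 0.
Proof. by case: k => // k _; rewrite /Tcst addr0 mulr0. Qed.

(** For [l = 1] or [k = 0] the constant in [T_{k,l}] completes the divisor sum to an Eisenstein
    series; otherwise it is 0 and the series is a derivative of one. *)
Lemma qmf_That k n : Tidx k n.+1 -> qmf (k + n.+1) (genser (That k n)).
Proof.
move=> [_ kn]; rewrite /That genserD genserZ genser1 genser_pp.
case: n kn => [|n] kn.
  have k0 : (0 < k)%N by case: k kn.
  rewrite tser_ge // subn0 /= (_ : Tcst k 1 = eisc (k + 1)); last first.
    by rewrite /Tcst eqn0Ngt k0 /= addr0 mulr1.
  rewrite -[k in sg k](addnK 1) subn1 -EisE; apply: qmf_Eis kn _.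
  by rewrite addn1.
case: (posnP k) kn => [->|k0] kn.
  rewrite tserC tser_ge // subn0 add0n /= (_ : Tcst 0 n.+2 = eisc n.+2); last first.
    by rewrite /Tcst add0r mulr1 add0n.
  by rewrite -[n.+1]/(n.+2.-1) -EisE; exact: qmf_Eis.
rewrite Tcst0 // scale0r add0r addnS; apply: qmf_tser_pos => //.
by move: kn; rewrite addnS /= negbK.
Qed.

(** The weight is attached to brackets, where the induced product is ordinary multiplication; all
    three gradings are compared with this one. *)
Inductive whom : nat -> Pfun -> Prop :=
| whom0 w : whom w 0
| whom1 : whom 0 1
| whomM w k n f : Tidx k n.+1 -> whom w f -> whom (k + n.+1 + w) (That k n * f)
| whomD w f g : whom w f -> whom w g -> whom w (f + g)
| whomZ w c f : whom w f -> whom w (c *: f).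

Lemma whom_eq w w' f : whom w f -> w = w' -> whom w' f.
Proof. by move=> + <-. Qed.

Lemma whom_mul w v f g : whom w f -> whom v g -> whom (w + v) (f * g).
Proof.
move=> Hf Hg; elim: Hf => {w f} [w||w k n f kn _ IH|w f f' _ IH _ IH'|w c f _ IH].
- by rewrite mul0r; exact: whom0.
- by rewrite mul1r.
- by rewrite -mulrA -addnA; exact: whomM.
- by rewrite mulrDl; exact: whomD.
- by rewrite -scalerAl; exact: whomZ.
Qed.

Lemma qmf_whom w f : whom w f -> qmf w (genser f).
Proof.
elim=> {w f} [w||w k n f kn _ IH|w f f' _ IH _ IH'|w c f _ IH].
- by rewrite -(scale0r (0 : Pfun)) genserZ scale0r; exact: qmf0.
- by rewrite genser1; exact: qmf1.
- by rewrite genserM; apply: qmfM => //; exact: qmf_That.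
- by rewrite genserD; exact: qmfD.
- by rewrite genserZ; exact: qmfZ.
Qed.

Lemma ppmul_tfun0_1 a : ppmul (tfun a 0) 1 = 0.
Proof.
apply: funext => l; rewrite /ppmul onepE; case: eqP => [->|_]; last by rewrite mulr0.
by rewrite mulr1 /tfun msum_vanish0.
Qed.

(** The derivation sends [That k n] to [That (k + a) n.+1], whose constant is 0, so it raises
    weights by exactly [a + 1]. *)
Lemma whom_ppmul_tfun0 w a f : odd a -> whom w f -> whom (w + a.+1) (ppmul (tfun a 0) f).
Proof.
move=> oa; have a0 : (0 < a)%N by case: a oa.
elim=> {w f} [w||w k n f kn Hf IH|w f f' _ IH _ IH'|w c f _ IH].
- by rewrite -(scale0r (0 : Pfun)) ppmulZ scale0r; exact: whom0.
- by rewrite ppmul_tfun0_1; exact: whom0.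
- rewrite (ppmul_leibniz _ _ (additive_tfun0 a)).
  have -> : ppmul (tfun a 0) (That k n) = That (k + a) n.+1.
    rewrite /That ppmulD ppmulZ ppmul_tfun0_1 scaler0 add0r ppmul_tfun0_pp.
    by rewrite Tcst0 ?addn_gt0 ?a0 ?orbT // scale0r add0r.
  apply: whomD; last by rewrite -addnA; exact: whomM.
  apply: (@whom_eq (k + a + n.+2 + w)); last by lia.
  apply: whomM => //; split=> //; case: kn => _.
  by rewrite (_ : k + a + n.+2 = k + n.+1 + a.+1)%N; [move=> /negbTE kn; rewrite oddD kn /= oa | lia].
- by rewrite ppmulD; exact: whomD.
- by rewrite ppmulZ; exact: whomZ.
Qed.

Definition indhom (w : nat) (f : Pfun) : Prop := exists2 H, whom w H & f = H * Z.

Lemma indhom_span (P : nat -> Pfun -> Prop) w f :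
  (forall g, P w g -> indhom w g) -> span (P w) f -> indhom w f.
Proof.
move=> HP; elim=> {f} [|f /HP //|f g _ [F HF ->] _ [G HG ->]|c f _ [F HF ->]].
- by exists 0; [exact: whom0 | rewrite mul0r].
- by exists (F + G); [exact: whomD | rewrite mulrDl].
- by exists (c *: F); [exact: whomZ | rewrite -scalerAl].
Qed.

Lemma indhom_odot v w f g h :
  indhom v f -> indhom w g -> odot_is f g h -> indhom (v + w) h.
Proof.
move=> [F HF ->] [G HG ->] /odot_isP ->; rewrite odotZ.
by exists (F * G) => //; exact: whom_mul.
Qed.

Lemma quasimodular_indhom (hom : nat -> Pfun -> Prop) :
  (forall w f, hom w f -> indhom w f) -> quasimodular hom.
Proof.
move=> Hh w f /Hh [H HH ->]; exists (genser H); split; last exact: qmf_whom.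
by rewrite /qbracket_is -[LHS]/(genser H * genser Z) genserM.
Qed.

Lemma Shom_indhom w f : Shom w f -> indhom w f.
Proof.
apply: (indhom_span (P := Smono)) => g; elim=> {w g f} [|k j f ej j2 _ [H HH ->]].
  by exists 1; [exact: whom1 | rewrite mul1r].
have oj : odd j.-1 by case: j ej j2 => // j; rewrite /= negbK.
(* Pointwise multiplication by [S_j] acts on brackets as multiplication by the bracket of [S_j] plus
   a derivation, and both raise the weight by [j]. *)
exists (That j.-1 0 * H + ppmul (tfun j.-1 0) H).
  apply: whomD.
    apply: (@whom_eq (j.-1 + 1 + k)); last by lia.
    by apply: whomM => //; split; rewrite // addn1 /= negbK.
  by rewrite -[j in (k + j)%N]prednK ?(ltnW j2) //; exact: whom_ppmul_tfun0.
have -> : Smom j = Tmom j.-1 1.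
  rewrite SmomE // TmomE; congr (_ *: _ + _).
  rewrite /Tcst addn1 prednK ?(ltnW j2) // (_ : (j.-1 == 0%N) = false); last by case: (j.-1) oj.
  by rewrite addr0 mulr1.
rewrite TmomE ppmulDl ppmulZl ppmul1 ppmul_tfun0.
rewrite scalerAl -mulrDl; congr (_ * _).
by rewrite /That [in RHS]mulrDl -scalerAl mul1r -addrA [_ + ppmul _ _]addrC.
Qed.

Lemma SymShom_indhom w f : SymShom w f -> indhom w f.
Proof.
apply: (indhom_span (P := SymSgen)) => g; elim=> {w g f} [k f|k j f g h _ Hf _ Hg].
  exact: Shom_indhom.
exact: indhom_odot.
Qed.

Lemma Thom_indhom w f : Thom w f -> indhom w f.
Proof.
apply: (indhom_span (P := Tmono)) => g; elim=> {w g f} [|w k [//|n] f h l1 kl _ Hf].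
  by exists 1; [exact: whom1 | rewrite mul1r].
apply: indhom_odot => //; exists (That k n); last exact: Tmom_That.
rewrite -[That k n]mulr1 -[(k + _)%N]addn0; apply: whomM => //; exact: whom1.
Qed.

Theorem theorem4p1p4 :
  (quasimodular Shom /\ closed_pointwise Salg) /\
  (quasimodular SymShom /\ closed_pointwise SymS /\ closed_induced SymS) /\
  (quasimodular Thom /\ closed_pointwise Talg /\ closed_induced Talg) /\
  strict_subset Salg SymS /\ strict_subset SymS Talg.
Proof.
split; [split | split; [split; [|split] | split; [split; [|split] | split]]].
- exact: quasimodular_indhom Shom_indhom.
- by move=> f g; exact: SalgM.
- exact: quasimodular_indhom SymShom_indhom.
- exact: SymS_pointwise.
- exact: SymS_induced.
- exact: quasimodular_indhom Thom_indhom.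
- by move=> f g; exact: TalgM.
- exact: Talg_induced.
- exact: Salg_SymS_strict.
- exact: SymS_Talg_strict.
Qed.
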